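(* Let $n,m\ge1$. The Kirillov--Wei operator $\mathbf{D}$ on $\mathscr{B}(m\varpi_1)$ induces on $\mathfrak{i}_m(\mathscr{B}(m\varpi_1))\subset\mathrm{Func}(\mathrm{wt}(m\varpi_1),S(\mathfrak{h}^* ))$ the operator $\widehat{\mathbf{D}}=\mathfrak{i}_m\circ\mathbf{D}\circ\mathfrak{i}_m^{-1}$ which acts as follows: for any symmetric functions $f$ and $g$, it maps the function $\mu\mapsto f[t_1+\dots+t_n]\,g[\mu_1t_1+\dots+\mu_nt_n]$ to the function $$\mu\mapsto\Bigl(\mu_1\frac{\partial}{\partial t_1}+\dots+\mu_n\frac{\partial}{\partial t_n}\Bigr)\bigl(f[t_1+\dots+t_n]\,g[\mu_1t_1+\dots+\mu_nt_n]\bigr)$$ $$+\,f[t_1+\dots+t_n]\sum_{\substack{1\le i,j\le n\\ i\ne j}}\frac{\mu_j(\mu_i+1)}{t_i-t_j}\bigl(g[\mu_1t_1+\dots+\mu_nt_n+(t_i-t_j)]-g[\mu_1t_1+\dots+\mu_nt_n]\bigr).$$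
   Context: $\mathfrak{gl}_n$ (complex $n\times n$ matrices) has matrix units $E_{ij}$ and coordinates $y_{ij}$; $c_k(Y)$ is the sum of the principal $k\times k$ minors of $Y$ ($c_0=1$). $\mathfrak{h}\subset\mathfrak{gl}_n$ is the subalgebra of diagonal matrices and $S(\mathfrak{h}^* )=\mathbb{C}[t_1,\dots,t_n]$ with $t_i$ the $i$-th diagonal entry. $V=V(m\varpi_1)=S^m(\mathbb{C}^n)$, with $\pi:\mathfrak{gl}_n\to\mathrm{End}\,V$. Its set of weights $\mathrm{wt}(m\varpi_1)$ is the set of $n$-tuples $\mu=(\mu_1,\dots,\mu_n)$ of non-negative integers with sum $m$; each weight space $V_\mu$ is one-dimensional. The Kirillov algebra $\mathscr{C}(V)$ is the algebra of $\mathrm{GL}_n$-equivariant polynomial maps $\mathfrak{gl}_n\to\mathrm{End}\,V$; $c\in S(\mathfrak{gl}_n^* )^{\mathfrak{gl}_n}$ is identified with $Y\mapsto c(Y)\,\mathrm{Id}_V$. The Kirillov--Wei operator is $(\mathbf{D}F)(Y)=\sum_{i,j=1}^n\frac{\partial F}{\partial y_{ji}}(Y)\cdot\pi(E_{ij})$. The big algebra $\mathscr{B}(m\varpi_1)$ is the subalgebra of $\mathscr{C}(V)$ generated by $\mathbf{D}^q(c_{p+q})$ for $p,q\ge0$, $p+q\le n$; it is preserved by $\mathbf{D}$. The injective algebra homomorphism $\mathfrak{i}_m:\mathscr{B}(m\varpi_1)\to\mathrm{Func}(\mathrm{wt}(m\varpi_1),S(\mathfrak{h}^* ))$ (functions on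 $\mathrm{wt}(m\varpi_1)$ with values in $S(\mathfrak{h}^* )$) sends $F$ to $\hat F$ such that $F(Y)$ acts on $V_\mu$ as the scalar $(\hat F(\mu))(Y)$ for all $\mu$ and all $Y\in\mathfrak{h}$. Its image is spanned by the functions $\mu\mapsto f[t_1+\dots+t_n]\,g[\mu_1t_1+\dots+\mu_nt_n]$ with $f,g$ symmetric functions. Symmetric functions are elements of the ring $\Lambda=\mathbb{C}[p_1,p_2,\dots]$ (power sums). Plethystic substitution $f\mapsto f[A]$ is the algebra homomorphism on $\Lambda$ with $p_k[\sum_i a_it_i]=\sum_i a_it_i^k$ for $k\ge1$, where the coefficients $a_i$ (e.g. $\mu_i$, $\pm1$) are treated as constants. Thus $f[\mu_1t_1+\dots+\mu_nt_n]=f(t_1,\dots,t_1,\dots,t_n,\dots,t_n)$ with each $t_i$ repeated $\mu_i$ times. *)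

(* Defs.v *)
From HB Require Import structures.
From mathcomp Require Import all_boot all_order all_algebra finmap.
From mathcomp Require Import reals complex.
(* monalg has its own, conflicting, notations {mpoly _[_]}, 'X_{1..n}, etc. *)
From mathcomp Require Import -(notations) monalg.
From mathcomp Require Import mpoly.

Set Implicit Arguments.
Unset Strict Implicit.
Unset Printing Implicit Defensive.

Import GRing.Theory.
Local Open Scope ring_scope.

(* S(gl_n^* ), where 'X_(mxvec_index i j) is the coordinate y_ij. *)
Notation gl_poly K n := {mpoly K[n * n]}.

(* wt(m varpi_1) = { mu in N^n | mu_1 + ... + mu_n = m } *)
Record wt (n m : nat) : predArgType :=
  Wt { wt_val :> 'X_{1..n < m.+1}; _ : mdeg wt_val == m }.

HB.instance Definition _ n m := [isSub for @wt_val n m].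
HB.instance Definition _ n m := [Finite of wt n m by <:].

(* V = S^m(K^n) is the space of homogeneous polynomials of degree m in the
   basis e_1 = 'X_1, ..., e_n = 'X_n of K^n.  Its vectors are the columns of
   their coordinates in the basis of monomials 'X_[mu], mu in wt(m varpi_1). *)
Notation dimV n m := #|{: wt n m}|.

Section Sym.
Variables (K : fieldType) (n m : nat).

(* The matrix, acting on columns, of an operator of K[x_1..x_n] that preserves
   the degree. *)
Definition op_mx (T : {mpoly K[n]} -> {mpoly K[n]}) : 'M[K]_(dimV n m) :=
  \matrix_(a, b) (T 'X_[enum_val b : wt n m])@_(enum_val a : wt n m).

(* g acts by the substitution e_j |-> g e_j = sum_i g_ij e_i *)
Definition GL_rep (g : 'M[K]_n) : 'M[K]_(dimV n m) :=
  op_mx (fun p => p \mPo [tuple \sum_(i < n) g i j *: 'X_i | j < n]).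

(* gl_rep is pi, the differential of GL_rep: X acts by the derivation extending
   e_j |-> X e_j *)
Definition gl_rep (X : 'M[K]_n) : 'M[K]_(dimV n m) :=
  op_mx (fun p => \sum_(i < n) \sum_(j < n) X i j *: ('X_i * p^`M(j))).

Definition weight_space (mu : wt n m) (v : 'cV[K]_(dimV n m)) : Prop :=
  forall H : 'M[K]_n, is_diag_mx H ->
    gl_rep H *m v = (\sum_(i < n) (mu i)%:R * H i i) *: v.

(* Polynomial maps gl_n -> End V; K is infinite in the applications, so that
   they are the same as matrices of polynomials. *)
Definition polymap : Type := 'M[gl_poly K n]_(dimV n m).

Definition ev (F : polymap) (Y : 'M[K]_n) : 'M[K]_(dimV n m) :=
  map_mx (meval (mxvec Y 0)) F.

(* Membership in the Kirillov algebra C(V). *)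
Definition kirillov (F : polymap) : Prop :=
  forall g Y : 'M[K]_n, g \in unitmx ->
    ev F (g *m Y *m invmx g) = GL_rep g *m ev F Y *m GL_rep (invmx g).

Definition generic_gl : 'M[gl_poly K n]_n :=
  \matrix_(i, j) 'X_(mxvec_index i j).

Definition principal_minor (S : {set 'I_n}) : gl_poly K n :=
  \det (\matrix_(a < #|S|, b < #|S|) generic_gl (enum_val a) (enum_val b)).

Definition c_ (k : nat) : gl_poly K n :=
  \sum_(S : {set 'I_n} | #|S| == k) principal_minor S.

Definition KW (F : polymap) : polymap :=
  \sum_(i < n) \sum_(j < n)
    map_mx (mderiv (mxvec_index j i)) F *m
    map_mx (@mpolyC (n * n) K) (gl_rep (delta_mx i j)).

(* The big algebra: the unital K-subalgebra generated by the D^q(c_{p+q}). *)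
Inductive big_algebra : polymap -> Prop :=
| big_gen p q : (p + q <= n)%N -> big_algebra (iter q KW (c_ (p + q))%:M)
| big_one : big_algebra 1%:M
| big_scale (a : K) F : big_algebra F -> big_algebra (a%:MP *: F)
| big_add F G : big_algebra F -> big_algebra G -> big_algebra (F + G)
| big_mul F G : big_algebra F -> big_algebra G -> big_algebra (F *m G).

(* Func(wt(m varpi_1), S(h^* )), where 'X_i is the coordinate t_i of h. *)
Definition wtfun : Type := {ffun wt n m -> {mpoly K[n]}}.

(* The graph of i_m: hat F phi means i_m(F) = phi. *)
Definition hat (F : polymap) (phi : wtfun) : Prop :=
  forall Y : 'M[K]_n, is_diag_mx Y ->
  forall (mu : wt n m) (v : 'cV[K]_(dimV n m)), weight_space mu v ->
    ev F Y *m v = (phi mu).@[fun i => Y i i] *: v.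

(* The graph of i_m o D o i_m^-1 : i_m(B) -> Func(wt, S(h^* )). *)
Definition Dhat (phi psi : wtfun) : Prop :=
  exists F, [/\ big_algebra F, hat F phi & hat (KW F) psi].

End Sym.

(* Lambda = K[p_1, p_2, ...]: finitely supported exponents on nat, the
   variable of index k being p_(k+1). *)
Notation Lambda K := (malg (cmonom nat) K).

(* pleth a f = f[sum_i a_i t_i] *)
Definition pleth (K : fieldType) (n : nat) (a : 'I_n -> K) (f : Lambda K) :
    {mpoly K[n]} :=
  monalg.mmap (@mpolyC n K)
    (fun e : cmonom nat =>
       \prod_(k <- finsupp e) (\sum_(i < n) a i *: 'X_i ^+ k.+1) ^+ e k) f.

Definition fg_fun (K : fieldType) (n m : nat) (f g : Lambda K) : wtfun K n m :=
  [ffun mu : wt n m => pleth (fun _ => 1) f * pleth (fun l => (mu l)%:R) g].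

(* Main.v *)
(* A GL_n-equivariant polynomial map F is determined by its values on diagonal
matrices, because diagonalizable matrices are dense, and these values are
diagonal in the basis of monomials.  Differentiating the equivariance of F along
1 + s E_ji gives (t_i - t_j) dF_Y(E_ji) = [pi(E_ji), F(Y)] at a diagonal Y, so
the diagonal restriction of D F is a first-order term plus divided differences
between mu and mu + e_i - e_j; this is the formula for D^.  For F^ = f g the
divided differences are polynomial, and D^ preserves the span of the functions
h(t) prod_k (sum_i mu_i t_i^k) with h symmetric: the terms mu_i^2 k t_i^(k-1)
coming from the derivative of sum_i mu_i t_i^k are exactly the missing diagonal
terms i = j of the double sum.  Hence all D^q(c_(p+q)) lie over this span.
Conversely D, being a derivation on scalar maps, sends the power sum
p_(k+1)(t), a polynomial in the c_k, to (k+1) sum_i mu_i t_i^k.  So the big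
algebra is the preimage of the span, and it is stable under D. *)
From HB Require Import structures.
Require Import Defs.
From mathcomp Require Import all_boot all_order perm all_algebra finmap.
From mathcomp Require Import reals complex.
From mathcomp Require Import -(notations) monalg.
From mathcomp Require Import mpoly ring zify.

Set Implicit Arguments.
Unset Strict Implicit.
Unset Printing Implicit Defensive.

Import Order.TTheory GRing.Theory Num.Theory.
Local Open Scope ring_scope.

(** * Polynomial identities and first-order expansions *)

Section PolynomialIdentities.
Variable K : numFieldType.

Lemma horner_eq0 (P : {poly K}) : (forall x, P.[x] = 0) -> P = 0.
Proof.
move=> P0; apply: contraTeq isT => Pn0.
(* Natural numbers stay distinct in [K], which gives [size P] roots, more than a nonzero [P] can
   have. *)
suff: (size [seq i%:R : K | i <- iota 0 (size P)] < size P)%N.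
  by rewrite size_map size_iota ltnn.
apply: max_poly_roots => //; first by apply/allP => x _; apply/rootP.
by rewrite map_inj_uniq ?iota_uniq // => i j /eqP; rewrite eqr_nat => /eqP.
Qed.

Lemma mpoly_alg_ind (n : nat) (P : {mpoly K[n]} -> Prop) :
    (forall c, P c%:MP) -> (forall i, P 'X_i) ->
    (forall p q, P p -> P q -> P (p + q)) ->
    (forall p q, P p -> P q -> P (p * q)) ->
  forall p, P p.
Proof.
move=> PC PX PD PM p; rewrite [p]mpolyE.
apply: (big_ind P) => [||m _]; [by rewrite -mpolyC0|exact: PD|].
rewrite -mul_mpolyC; apply: (PM) => //; rewrite mpolyXE_id.
apply: (big_ind P) => [||i _]; [by rewrite -mpolyC1|exact: PM|].
elim: (m i) => [|k IH]; first by rewrite expr0 -mpolyC1.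
by rewrite exprS; apply: (PM).
Qed.

(** Vector-valued polynomial functions of one variable, given by closure rules that pass through
    linear and bilinear maps; [polyfun_ext] stands in for functional extensionality. *)
Inductive polyfun (V : lmodType K) : (K -> V) -> Prop :=
| polyfun_mon k v : polyfun (fun s => s ^+ k *: v)
| polyfun_add r1 r2 : polyfun r1 -> polyfun r2 -> polyfun (fun s => r1 s + r2 s)
| polyfun_ext r1 r2 : r1 =1 r2 -> polyfun r1 -> polyfun r2.

(* The first-order jet at [s = 0] of a polynomial curve. *)
Definition tang (V : lmodType K) (phi : K -> V) (a b : V) : Prop :=
  exists2 r, polyfun r & forall s, phi s = a + s *: b + s ^+ 2 *: r s.

Lemma polyfun_lin (V W : lmodType K) (f : {linear V -> W}) r :
  polyfun r -> polyfun (f \o r).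
Proof.
elim=> {r} [k v|r1 r2 _ h1 _ h2|r1 r2 e _ h].
- by apply: polyfun_ext (polyfun_mon k (f v)) => s /=; rewrite linearZ.
- by apply: polyfun_ext (polyfun_add h1 h2) => s /=; rewrite linearD.
- by apply: polyfun_ext h => s /=; rewrite e.
Qed.

Lemma polyfun_scale (V : lmodType K) k (r : K -> V) :
  polyfun r -> polyfun (fun s => s ^+ k *: r s).
Proof.
elim=> {r} [l v|r1 r2 _ h1 _ h2|r1 r2 e _ h].
- by apply: polyfun_ext (polyfun_mon (k + l) v) => s; rewrite exprD scalerA.
- by apply: polyfun_ext (polyfun_add h1 h2) => s; rewrite scalerDr.
- by apply: polyfun_ext h => s; rewrite e.
Qed.

Section Bilinear.
Variables (U V W : lmodType K) (B : U -> V -> W).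
Hypothesis Bl : forall v a u u', B (a *: u + u') v = a *: B u v + B u' v.
Hypothesis Br : forall u a v v', B u (a *: v + v') = a *: B u v + B u v'.

Let BlD v u u' : B (u + u') v = B u v + B u' v.
Proof. by rewrite -[u]scale1r Bl !scale1r. Qed.
Let BrD u v v' : B u (v + v') = B u v + B u v'.
Proof. by rewrite -[v]scale1r Br !scale1r. Qed.
Let B0l v : B 0 v = 0.
Proof. by apply: (addIr (B 0 v)); rewrite -BlD !add0r. Qed.
Let B0r u : B u 0 = 0.
Proof. by apply: (addIr (B u 0)); rewrite -BrD !add0r. Qed.
Let BlZ v a u : B (a *: u) v = a *: B u v.
Proof. by rewrite -[a *: u]addr0 Bl B0l addr0. Qed.
Let BrZ u a v : B u (a *: v) = a *: B u v.
Proof. by rewrite -[a *: v]addr0 Br B0r addr0. Qed.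

Lemma polyfun_bil r1 r2 :
  polyfun r1 -> polyfun r2 -> polyfun (fun s => B (r1 s) (r2 s)).
Proof.
move=> h1 h2; elim: h1 => {r1} [k u|r r' _ h _ h'|r r' e _ h].
- apply: (@polyfun_ext _ (fun s => s ^+ k *: B u (r2 s))) => [s|].
    by rewrite BlZ.
  apply: polyfun_scale; elim: h2 => {r2} [l v|r r' _ h _ h'|r r' e _ h].
  + by apply: polyfun_ext (polyfun_mon l (B u v)) => s; rewrite BrZ.
  + by apply: polyfun_ext (polyfun_add h h') => s; rewrite BrD.
  + by apply: polyfun_ext h => s; rewrite e.
- by apply: polyfun_ext (polyfun_add h h') => s; rewrite BlD.
- by apply: polyfun_ext h => s; rewrite e.
Qed.

(** The Leibniz rule. *)
Lemma tang_bil phi psi a b c d : tang phi a b -> tang psi c d ->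
  tang (fun s => B (phi s) (psi s)) (B a c) (B a d + B b c).
Proof.
case=> r hr er [q hq eq].
(* All terms of order at least two in the product of the jets, divided by [s ^+ 2]. *)
exists (fun s => B b d + B a (q s) + B (r s) c
          + (s ^+ 1 *: B b (q s) + s ^+ 1 *: B (r s) d
          + s ^+ 2 *: B (r s) (q s))).
  have cst (X : lmodType K) (x : X) : polyfun (fun=> x).
    by apply: polyfun_ext (polyfun_mon 0 x) => s; rewrite expr0 scale1r.
  by do ![apply: polyfun_add | apply: polyfun_bil | apply: polyfun_scale |
          apply: cst | assumption].
move=> s; rewrite er eq !(BlD, BrD, BlZ, BrZ) !scalerDr !scalerA expr1.
rewrite -!exprD -!exprSr -!exprS -!expr2 !addrA.
by rewrite [LHS](ACl (1*2*4*5*3*7*6*8*9)).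
Qed.
End Bilinear.

Lemma tang_ext (V : lmodType K) (phi psi : K -> V) a b a' b' :
  phi =1 psi -> a = a' -> b = b' -> tang phi a b -> tang psi a' b'.
Proof. by move=> e <- <- [r hr er]; exists r => // s; rewrite -e er. Qed.

Lemma tang_affine (V : lmodType K) (a b : V) : tang (fun s => a + s *: b) a b.
Proof.
exists (fun s => s ^+ 0 *: 0) => [|s]; first exact: polyfun_mon.
by rewrite !scaler0 addr0.
Qed.

Lemma tang_cst (V : lmodType K) (a : V) : tang (fun=> a) a 0.
Proof.
by apply: tang_ext (tang_affine a 0) => // s; rewrite scaler0 addr0.
Qed.

Lemma tang_lin (V W : lmodType K) (f : V -> W) (fl : linear f) phi a b :
  tang phi a b -> tang (f \o phi) (f a) (f b).
Proof.
pose F := GRing.isLinear.Build K V W _ f fl.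
pose f' : {linear V -> W} := HB.pack f F.
case=> r hr er; exists (f \o r); first exact: (polyfun_lin f' hr).
by move=> s /=; rewrite er -[f]/(f' : V -> W) !linearD !linearZ.
Qed.

Lemma tang_add (V : lmodType K) (phi psi : K -> V) a b c d :
  tang phi a b -> tang psi c d ->
  tang (fun s => phi s + psi s) (a + c) (b + d).
Proof.
case=> r hr er [q hq eq]; exists (fun s => r s + q s).
  exact: polyfun_add.
by move=> s; rewrite er eq !scalerDr !addrA [LHS](ACl (1*4*2*5*3*6)).
Qed.

Lemma tang_sum (V : lmodType K) (I : Type) (l : seq I) (phi : I -> K -> V) a b :
  (forall i, tang (phi i) (a i) (b i)) ->
  tang (fun s => \sum_(i <- l) phi i s) (\sum_(i <- l) a i) (\sum_(i <- l) b i).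
Proof.
move=> h; elim: l => [|i l IH].
  by apply: tang_ext (tang_cst 0) => [s||]; rewrite big_nil.
by apply: tang_ext (tang_add (h i) IH) => [s||]; rewrite big_cons.
Qed.

(** The remainders being polynomial, two expansions of one curve differ by a polynomial in [s] that
    vanishes identically, so coefficients can be compared. Identities are differentiated below by
    computing the jets of both sides. *)
Lemma tang_uniq (phi psi : K -> K^o) a b c d :
  tang phi a b -> tang psi c d -> phi =1 psi -> a = c /\ b = d.
Proof.
have horn (r : K -> K^o) : polyfun r -> exists P : {poly K}, forall s, r s = P.[s].
  elim=> {r} [k v|r1 r2 _ [P hP] _ [Q hQ]|r1 r2 e _ [P hP]].
  - by exists (v *: 'X^k) => s; rewrite !hornerE mulrC.
  - by exists (P + Q) => s; rewrite hornerD hP hQ.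
  - by exists P => s; rewrite -e.
case=> r /horn[P hP] er [q /horn[Q hQ] eq] e.
have /polyP E : (a - c)%:P + (b - d) *: 'X + (P - Q) * 'X^2 = 0.
  apply: horner_eq0 => s; rewrite !hornerE.
  have := e s; rewrite er eq hP hQ => /eqP; rewrite -subr_eq0 => /eqP <-.
  by rewrite /GRing.scale /=; ring.
have := E 0; have := E 1%N.
rewrite !coefD !coefMXn !coefZ !coefX !coefC /= !(mulr0, mulr1, addr0, add0r).
by move=> /eqP + /eqP; rewrite !subr_eq0 => /eqP -> /eqP ->.
Qed.

Lemma tang_mx (p q : nat) (phi : K -> 'M[K]_(p, q)) (a b : 'M[K]_(p, q)) :
  (forall i j, tang (fun s => phi s i j : K^o) (a i j) (b i j)) ->
  tang phi a b.
Proof.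
move=> h; pose D i j (x : K^o) : 'M[K]_(p, q) := x *: delta_mx i j.
have Dl i j : linear (D i j) by move=> c x y; rewrite /D scalerDl scalerA.
have T i j := tang_lin (Dl i j) (h i j).
have := tang_sum (index_enum 'I_p) (fun i => tang_sum (index_enum 'I_q) (T i)).
by apply: tang_ext => [s||]; rewrite /= /D -matrix_sum_delta.
Qed.

Lemma tang_mx_uniq (p q : nat) (phi psi : K -> 'M[K]_(p, q)) (a b c d : 'M[K]_(p, q)) :
  tang phi a b -> tang psi c d -> phi =1 psi -> a = c /\ b = d.
Proof.
move=> h1 h2 e.
have el i j : linear (fun A : 'M[K]_(p, q) => A i j : K^o).
  by move=> x A B; rewrite !mxE.
have E i j := tang_uniq (tang_lin (el i j) h1) (tang_lin (el i j) h2)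
                (fun s => congr1 (fun A : 'M_(p, q) => A i j) (e s)).
by split; apply/matrixP => i j; case: (E i j).
Qed.

Lemma tang_mulmx (p q r : nat) (phi : K -> 'M[K]_(p, q)) (psi : K -> 'M[K]_(q, r))
    (a b : 'M[K]_(p, q)) (c d : 'M[K]_(q, r)) :
  tang phi a b -> tang psi c d ->
  tang (fun s => phi s *m psi s) (a *m c) (a *m d + b *m c).
Proof.
apply: (@tang_bil _ _ _ (fun A B => A *m B)) => [C x A B|C x A B].
  by rewrite mulmxDl scalemxAl.
by rewrite mulmxDr scalemxAr.
Qed.

(** The chain rule, for substitution of polynomials because [GL_rep] is defined by substitution. *)
Lemma tang_comp_mpoly (n k : nat) (p : {mpoly K[n]}) (x y : 'I_n -> {mpoly K[k]}) :
  tang (fun s => p \mPo [tuple x i + s *: y i | i < n])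
    (p \mPo [tuple x i | i < n])
    (\sum_(i < n) (p^`M(i) \mPo [tuple x i | i < n]) * y i).
Proof.
elim/mpoly_alg_ind: p => [c|i|p q hp hq|p q hp hq].
- apply: tang_ext (tang_cst c%:MP) => [s||]; rewrite ?comp_mpolyC //.
  by rewrite big1 // => i _; rewrite mderivC comp_mpoly0 mul0r.
- apply: tang_ext (tang_affine (x i) (y i)) => [s||].
  + by rewrite comp_mpolyXU -tnth_nth tnth_mktuple.
  + by rewrite comp_mpolyXU -tnth_nth tnth_mktuple.
  + rewrite (bigD1 i) //= mderivX mnm1E eqxx scale1r -{1}[U_(i)%MM]add0m addmK mpolyX0 comp_mpoly1.
    rewrite mul1r big1 ?addr0 // => j /negbTE ji.
    by rewrite mderivX mnm1E eq_sym ji scale0r comp_mpoly0 mul0r.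
- apply: tang_ext (tang_add hp hq) => [s||]; rewrite ?comp_mpolyD //.
  rewrite -big_split; apply: eq_bigr => i _.
  by rewrite mderivD comp_mpolyD mulrDl.
- have Bl Q c (P P' : {mpoly K[k]}) : (c *: P + P') * Q = c *: (P * Q) + P' * Q.
    by rewrite mulrDl -scalerAl.
  have Br P c (Q Q' : {mpoly K[k]}) : P * (c *: Q + Q') = c *: (P * Q) + P * Q'.
    by rewrite mulrDr -scalerAr.
  apply: tang_ext (tang_bil Bl Br hp hq) => [s||]; rewrite ?rmorphM //.
  rewrite mulr_sumr mulr_suml -big_split; apply: eq_bigr => i _ /=.
  by rewrite mderivM comp_mpolyD !rmorphM /=; ring.
Qed.

Lemma tang_meval (n : nat) (p : {mpoly K[n]}) (x y : 'I_n -> K) :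
  tang (fun s => p.@[fun i => x i + s * y i] : K^o)
    p.@[x] (\sum_(i < n) p^`M(i).@[x] * y i).
Proof.
(* Evaluation is substitution of constants, read off at the only point of the zero-dimensional
   space. *)
pose e (P : {mpoly K[0]}) : K^o := P.@[fun=> 0].
have el : linear e by move=> c P Q; rewrite /e mevalD mevalZ.
have := tang_lin el (tang_comp_mpoly p (fun i => (x i)%:MP) (fun i => (y i)%:MP)).
have E (z : 'I_n -> K) (q : {mpoly K[n]}) :
    e (q \mPo [tuple (z i)%:MP | i < n]) = q.@[z].
  by rewrite /e comp_mpoly_meval; apply: meval_eq => i; rewrite tnth_mktuple mevalC.
apply: tang_ext => [s||] /=; last 2 first.
- exact: E.
- rewrite /e rmorph_sum; apply: eq_bigr => i _ /=.
  by rewrite mevalM mevalC -[RHS]/(_ * _) -E.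
rewrite /e comp_mpoly_meval; apply: meval_eq => i.
by rewrite tnth_mktuple mevalD mevalZ !mevalC.
Qed.

(* Polynomials vanishing everywhere: their derivatives vanish everywhere, so
   all Taylor coefficients at the origin are zero. *)
Lemma meval_eq0 (n : nat) (p : {mpoly K[n]}) : (forall v, p.@[v] = 0) -> p = 0.
Proof.
move=> p0; apply/mpolyP => m; rewrite mcoeff0.
have [d] := ubnP (mdeg m); elim: d m p p0 => // d IH m p p0 dm.
have [->|m0] := eqVneq m 0%MM.
  rewrite -[RHS](p0 (fun=> 0)).
  elim/mpoly_alg_ind: (p) => [c|i|q r|q r].
  - by rewrite mpolyCK mevalC.
  - by rewrite mcoeffX mnm1_eq0 mevalXU.
  - by rewrite mcoeffD mevalD => -> ->.
  - by rewrite mevalM => <- <-; exact: (rmorphM (@mcoeff n K 0%MM)).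
have [i mi] : exists i, m i != 0%N.
  apply/existsP; rewrite -[[exists _, _]]negbK negb_exists; apply: contra m0 => /forallP h.
  by apply/eqP/mnmP => i; rewrite mnm0E; apply/eqP; rewrite -[_ == _]negbK.
have Em : (m - U_(i) + U_(i))%MM = m by rewrite submK // lep1mP.
have D0 v : p^`M(i).@[v] = 0.
  have := tang_uniq (tang_meval p v (fun j => (j == i)%:R)) (tang_cst 0).
  case=> [s|_]; first exact: p0.
  rewrite (bigD1 i) //= eqxx mulr1 big1 ?addr0 // => j /negbTE->.
  by rewrite mulr0.
have := IH (m - U_(i))%MM _ D0; rewrite mcoeff_deriv Em.
have -> : (mdeg (m - U_(i)) < d)%N.
  by move: dm; rewrite -{1}Em mdegD mdeg1 addn1.
by move=> /(_ isT)/eqP; rewrite mulrn_eq0 => /eqP.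
Qed.
End PolynomialIdentities.

(** * The symmetric power representation *)

Section SymmetricPower.
Variables (K : numFieldType) (n m : nat).
Implicit Types (X Y g h : 'M[K]_n) (a b : 'I_(dimV n m)) (mu nu : wt n m).

Lemma wt_mdeg mu : mdeg mu = m.
Proof. by case: mu => k /= /eqP. Qed.

Lemma wt_inj mu nu : mu = nu :> 'X_{1..n} -> mu = nu.
Proof. by move=> e; do 2!apply: val_inj. Qed.

Lemma enum_wt_eq a b :
  ((enum_val a : wt n m) == (enum_val b : wt n m) :> 'X_{1..n}) = (a == b).
Proof. by apply/eqP/eqP => [/wt_inj/enum_val_inj|->]. Qed.

Lemma mdeg_wt (k : 'X_{1..n}) : mdeg k = m -> exists mu : wt n m, mu = k :> 'X_{1..n}.
Proof.
move=> dk; have lt_k : (mdeg k < m.+1)%N by rewrite dk.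
have eq_k : mdeg (BMultinom lt_k) == m by apply/eqP.
by exists (Wt eq_k).
Qed.

(** The weights index exactly the monomials of degree [m]; this makes composition of operators
    correspond to the product of their matrices. *)
Lemma homog_expand (p : {mpoly K[n]}) : p \is m.-homog ->
  p = \sum_(a < dimV n m) p@_(enum_val a : wt n m) *: 'X_[enum_val a : wt n m].
Proof.
move=> hp; apply/mpolyP => k; rewrite linear_sum /=.
have [dk|dk] := eqVneq (mdeg k) m; last first.
  rewrite (dhomog_nemf_coeff hp) // big1 // => a _.
  rewrite mcoeffZ mcoeffX; case: eqP => [e|]; rewrite ?mulr0 //.
  by rewrite -e wt_mdeg eqxx in dk.
have [mu emu] := mdeg_wt dk.
rewrite (bigD1 (enum_rank mu)) //= enum_rankK mcoeffZ mcoeffX emu eqxx mulr1.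
rewrite big1 ?addr0 // => a ha; rewrite mcoeffZ mcoeffX.
case: eqP => [e|]; rewrite ?mulr0 //.
by case/eqP: ha; rewrite -(enum_valK a); congr enum_rank; apply: wt_inj; rewrite e.
Qed.

Lemma homogX mu : 'X_[K, mu] \is m.-homog.
Proof. by rewrite dhomogX; apply/eqP/wt_mdeg. Qed.

Lemma op_mx_comp (T1 : {linear {mpoly K[n]} -> {mpoly K[n]}})
    (T2 : {mpoly K[n]} -> {mpoly K[n]}) :
  (forall p, p \is m.-homog -> T2 p \is m.-homog) ->
  op_mx m T1 *m op_mx m T2 = op_mx m (T1 \o T2).
Proof.
move=> h2; apply/matrixP => a b; rewrite !mxE /=.
rewrite [T2 _ in RHS](homog_expand (h2 _ (homogX _))).
rewrite !linear_sum; apply: eq_bigr => c _.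
by rewrite !mxE !linearZ /= mulrC.
Qed.

Definition subst_lin g : n.-tuple {mpoly K[n]} :=
  [tuple \sum_(i < n) g i j *: 'X_i | j < n].

Lemma homog_subst g p : p \is m.-homog -> p \mPo subst_lin g \is m.-homog.
Proof.
move=> hp; rewrite comp_mpolyE big_seq; apply: rpred_sum => k kp; apply: rpredZ.
have <- : mdeg k = m by apply: (dhomog_mf hp).
rewrite mdegE; apply: (big_ind2 (fun (q : {mpoly K[n]}) d => q \is d.-homog)).
- exact: dhomog1.
- by move=> q d q' d' hq hq'; apply: dhomogM.
- move=> i _; rewrite tnth_mktuple.
  suff /(dhomogMn (k i)) : \sum_(j < n) g j i *: 'X_j \is 1.-homog by rewrite mul1n.
  by apply: rpred_sum => j _; apply: rpredZ; rewrite dhomogX; apply/eqP/mdeg1.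
Qed.

Lemma GL_rep_mul g h : GL_rep m g *m GL_rep m h = GL_rep m (g *m h).
Proof.
rewrite (@op_mx_comp (comp_mpoly (subst_lin g))); last exact: homog_subst.
apply/matrixP => a b; rewrite !mxE; congr mcoeff => /=.
elim/mpoly_alg_ind: 'X_[_] => [c|j|p q hp hq|p q hp hq].
- by rewrite !comp_mpolyC.
- rewrite !comp_mpolyXU -!tnth_nth !tnth_mktuple raddf_sum /=.
  under eq_bigr => i _.
    rewrite comp_mpolyZ comp_mpolyXU -tnth_nth tnth_mktuple scaler_sumr; over.
  rewrite exchange_big; apply: eq_bigr => i _ /=.
  rewrite mxE scaler_suml; apply: eq_bigr => k _.
  by rewrite scalerA mulrC.
- by rewrite !comp_mpolyD hp hq.
- by rewrite !rmorphM /= hp hq.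
Qed.

Lemma GL_rep1 : GL_rep m 1%:M = 1%:M :> 'M[K]_(dimV n m).
Proof.
apply/matrixP => a b; rewrite !mxE.
have -> : [tuple \sum_(i < n) (1%:M : 'M[K]_n) i j *: 'X_i | j < n]
          = [tuple 'X_j | j < n].
  apply: eq_from_tnth => j; rewrite !tnth_mktuple (bigD1 j) //= mxE eqxx scale1r.
  by rewrite big1 ?addr0 // => i /negbTE ij; rewrite mxE ij scale0r.
by rewrite comp_mpoly_id mcoeffX enum_wt_eq eq_sym.
Qed.

Lemma GL_repV g : g \in unitmx -> GL_rep m g *m GL_rep m (invmx g) = 1%:M.
Proof. by move=> gu; rewrite GL_rep_mul mulmxV // GL_rep1. Qed.

Lemma GL_repVl g : g \in unitmx -> GL_rep m (invmx g) *m GL_rep m g = 1%:M.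
Proof. by move=> gu; rewrite GL_rep_mul mulVmx // GL_rep1. Qed.

(** The substitution moves each ['X_j] along a line with direction [X e_j], and the chain rule
    produces the derivation that defines [gl_rep]. *)
Lemma tang_GL_rep X :
  tang (fun s => GL_rep m (1%:M + s *: X)) 1%:M (gl_rep m X).
Proof.
apply: tang_mx => a b.
have ml : linear (fun p : {mpoly K[n]} => p@_(enum_val a : wt n m) : K^o).
  by move=> c p q; rewrite mcoeffD mcoeffZ.
have := tang_lin ml (tang_comp_mpoly 'X_[enum_val b : wt n m]
  (fun j => 'X_j) (fun j => \sum_i X i j *: 'X_i)).
apply: tang_ext => [s||] /=.
- rewrite mxE; congr (mcoeff _ (_ \mPo _)).
  apply: eq_from_tnth => j; rewrite !tnth_mktuple.
  under [RHS]eq_bigr => i _ do rewrite !mxE scalerDl -scalerA.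
  rewrite big_split -scaler_sumr /=; congr (_ + _).
  rewrite (bigD1 j) //= eqxx scale1r big1 ?addr0 // => i /negbTE ->.
  by rewrite scale0r.
- have := GL_rep1; move/matrixP => /(_ a b) <-; rewrite mxE.
  rewrite comp_mpoly_id; congr mcoeff; rewrite -[LHS]comp_mpoly_id.
  congr (_ \mPo _); apply: eq_from_tnth => j; rewrite !tnth_mktuple (bigD1 j) //= mxE.
  by rewrite eqxx scale1r big1 ?addr0 // => i /negbTE ij; rewrite mxE ij scale0r.
- rewrite mxE; congr mcoeff; rewrite exchange_big; apply: eq_bigr => j _ /=.
  rewrite comp_mpoly_id mulr_sumr; apply: eq_bigr => i _.
  by rewrite mulrC scalerAl.
Qed.

(** Multiplying the [j]-th derivative of ['X_[nu]] by ['X_i] gives [nu j] times the monomial of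
    exponent [nu - U_(j) + U_(i)]. Exponents are matched by additions only, to avoid truncated
    subtraction; if [nu j] is zero, the coefficient vanishes anyway. *)
Lemma gl_repE X a b : gl_rep m X a b =
  \sum_(i < n) \sum_(j < n) X i j * ((enum_val b : wt n m) j)%:R *
    ((enum_val b : wt n m) + U_(i) == (enum_val a : wt n m) + U_(j))%MM%:R.
Proof.
rewrite mxE raddf_sum; apply: eq_bigr => i _; rewrite raddf_sum; apply: eq_bigr => j _ /=.
rewrite mcoeffZ -mulrA; congr (_ * _); rewrite mderivX -scalerAr mcoeffZ -mpolyXD mcoeffX.
have [->|bj] := eqVneq ((enum_val b : wt n m) j) 0%N; first by rewrite !mul0r.
rewrite -(eqm_add2r U_(j)%MM) -addmA submK ?lep1mP //.
by rewrite [(U_(i) + _)%MM]addmC.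
Qed.

Lemma gl_rep_diag X : is_diag_mx X ->
  gl_rep m X = diag_mx (\row_a \sum_(i < n) ((enum_val a : wt n m) i)%:R * X i i).
Proof.
move=> dX; apply/matrixP => a b; rewrite gl_repE !mxE.
have E i : \sum_(j < n) X i j * ((enum_val b : wt n m) j)%:R *
    ((enum_val b : wt n m) + U_(i) == (enum_val a : wt n m) + U_(j))%MM%:R
    = ((enum_val b : wt n m) i)%:R * X i i *+ (a == b).
  rewrite (bigD1 i) //= big1 ?addr0 => [|j ji]; last first.
    by have /is_diag_mxP -> := dX; rewrite ?mul0r // eq_sym.
  rewrite eqm_add2r [X i i * _]mulrC mulr_natr; by rewrite enum_wt_eq eq_sym.
rewrite (eq_bigr _ (fun i _ => E i)) -sumrMnl.
by case: eqP => [->|]; rewrite ?mulr1n ?mulr0n.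
Qed.

Lemma gl_rep_linear : linear (@gl_rep K n m).
Proof.
move=> c X Y; apply/matrixP => a b; rewrite [in RHS]mxE [in X in _ = X + _]mxE !gl_repE.
rewrite mulr_sumr -big_split; apply: eq_bigr => i _ /=.
rewrite mulr_sumr -big_split; apply: eq_bigr => j _ /=.
by rewrite !mxE; ring.
Qed.

(** Both sides are the derivative at [s = 0] of [GL_rep] along the curve [g (1 + s X) g^-1]. *)
Lemma gl_rep_conj g X : g \in unitmx ->
  GL_rep m g *m gl_rep m X *m GL_rep m (invmx g) = gl_rep m (g *m X *m invmx g).
Proof.
move=> gu.
have h1 := tang_mulmx (tang_mulmx (tang_cst (GL_rep m g)) (tang_GL_rep X))
             (tang_cst (GL_rep m (invmx g))).
have [s|_] := tang_mx_uniq h1 (tang_GL_rep (g *m X *m invmx g)); last first.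
  by rewrite mulmx0 mul0mx addr0 add0r.
rewrite !GL_rep_mul; congr (GL_rep m _).
by rewrite mulmxDr mulmx1 mulmxDl mulmxV // -scalemxAr -scalemxAl.
Qed.

Lemma GL_rep_diag X : is_diag_mx X ->
  GL_rep m X = diag_mx (\row_a \prod_(i < n) X i i ^+ (enum_val a : wt n m) i).
Proof.
move=> dX; apply/matrixP => a b; rewrite !mxE comp_mpolyX.
have E i : tnth [tuple \sum_(i < n) X i j *: 'X_i | j < n] i = X i i *: 'X_i.
  rewrite tnth_mktuple (bigD1 i) //= big1 ?addr0 // => j ji.
  by have /is_diag_mxP -> := dX; rewrite ?scale0r.
under eq_bigr => i _ do rewrite E exprZn.
rewrite scaler_prod -mpolyXE_id mcoeffZ mcoeffX enum_wt_eq eq_sym.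
by case: eqP => [->|]; rewrite ?mulr1 ?mulr0.
Qed.

End SymmetricPower.

(** * Equivariant polynomial maps *)

HB.instance Definition _ (K : numFieldType) n m :=
  GRing.isLinear.Build K _ _ _ (@gl_rep K n m) (@gl_rep_linear K n m).

(** * Invariance of the Casimir tensor of gl_n *)

Section MatrixUnits.
Variables (K : numFieldType) (n d : nat).
Implicit Types (f : {linear 'M[K]_n -> 'M[K]_d}) (g Y : 'M[K]_n).

Lemma delta_mulmx i j g :
  delta_mx i j *m g = \sum_l g j l *: (delta_mx i l : 'M[K]_n).
Proof.
apply/matrixP => a b; rewrite !mxE summxE (bigD1 j) //= big1 ?addr0 => [|k /negbTE kj].
  rewrite (bigD1 b) //= big1 ?addr0 => [|l /negbTE lb]; rewrite !mxE ?eqxx ?andbT.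
    by rewrite mulrC.
  by rewrite [b == l]eq_sym lb andbF mulr0.
by rewrite mxE kj andbF mul0r.
Qed.

Lemma mulmx_delta i j g :
  g *m delta_mx i j = \sum_k g k i *: (delta_mx k j : 'M[K]_n).
Proof.
apply/matrixP => a b; rewrite !mxE summxE (bigD1 i) //= big1 ?addr0 => [|k /negbTE kj].
  rewrite (bigD1 a) //= big1 ?addr0 => [|l /negbTE lb]; rewrite !mxE ?eqxx //=.
  by rewrite eq_sym lb mulr0.
by rewrite mxE kj mulr0.
Qed.

(** Expanding [E_ji g] in matrix units leaves scalars [g i l], which recombine into a left
    multiplication by [g] in the other factor. *)
Lemma casimir_mulr f f' g :
  \sum_i \sum_j f (delta_mx j i *m g) *m f' (delta_mx i j) =
  \sum_i \sum_j f (delta_mx j i) *m f' (g *m delta_mx i j).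
Proof.
transitivity (\sum_i \sum_j \sum_l g i l *: (f (delta_mx j l) *m f' (delta_mx i j))).
  apply: eq_bigr => i _; apply: eq_bigr => j _.
  rewrite delta_mulmx linear_sum mulmx_suml; apply: eq_bigr => l _.
  by rewrite linearZ -scalemxAl.
under eq_bigr => i _ do rewrite exchange_big.
rewrite exchange_big; apply: eq_bigr => i _ /=; rewrite exchange_big.
apply: eq_bigr => j _ /=; rewrite mulmx_delta linear_sum mulmx_sumr.
by apply: eq_bigr => l _; rewrite linearZ -scalemxAr.
Qed.

Lemma casimir_mull f f' g :
  \sum_i \sum_j f (g *m delta_mx j i) *m f' (delta_mx i j) =
  \sum_i \sum_j f (delta_mx j i) *m f' (delta_mx i j *m g).
Proof.
apply: eq_bigr => i _.
transitivity (\sum_j \sum_l g l j *: (f (delta_mx l i) *m f' (delta_mx i j))).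
  apply: eq_bigr => j _; rewrite mulmx_delta linear_sum mulmx_suml.
  by apply: eq_bigr => l _; rewrite linearZ -scalemxAl.
rewrite exchange_big; apply: eq_bigr => j _ /=.
rewrite delta_mulmx linear_sum mulmx_sumr; apply: eq_bigr => l _.
by rewrite linearZ -scalemxAr.
Qed.

(* The invariance of the Casimir tensor [sum_ij E_ji (x) E_ij]. *)
Lemma casimir_conj f f' g : g \in unitmx ->
  \sum_i \sum_j f (invmx g *m delta_mx j i *m g) *m f' (invmx g *m delta_mx i j *m g) =
  \sum_i \sum_j f (delta_mx j i) *m f' (delta_mx i j).
Proof.
move=> gu.
under eq_bigr => i _ do under eq_bigr => j _ do rewrite -mulmxA.
(* The right-hand [g] of the first factor moves to the second and cancels [invmx g] there; then
   [invmx g] moves over and cancels the other [g]. *)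
rewrite (casimir_mulr (f \o mulmx (invmx g)) (f' \o mulmxr g \o mulmx (invmx g))) /=.
under eq_bigr => i _ do under eq_bigr => j _ do rewrite mulKmx //.
rewrite (casimir_mull f (f' \o mulmxr g)) /=.
by under eq_bigr => i _ do under eq_bigr => j _ do rewrite mulmxKV //.
Qed.
End MatrixUnits.

Lemma mulmx_conj (R : pzRingType) d (G V A B : 'M[R]_d) : V *m G = 1%:M ->
  (G *m A *m V) *m (G *m B *m V) = G *m (A *m B) *m V.
Proof. by move=> VG; rewrite !mulmxA -[G *m A *m V *m G]mulmxA VG mulmx1. Qed.

Lemma mulmx_comm_conj (R : pzRingType) d (G V A : 'M[R]_d) : V *m G = 1%:M ->
  A = G *m A *m V -> A *m G = G *m A.
Proof. by move=> VG e; rewrite {1}e -[LHS]mulmxA VG mulmx1. Qed.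

(** * Derivatives of equivariant maps, and their restriction to diagonal matrices *)

Section Kirillov.
Variables (K : numFieldType) (n m : nat).
Implicit Types (X Y Z g h : 'M[K]_n) (F G : polymap K n m) (a b : 'I_(dimV n m)).

Lemma evD F G Y : ev (F + G) Y = ev F Y + ev G Y.
Proof. exact: map_mxD. Qed.

Lemma evM F G Y : ev (F *m G) Y = ev F Y *m ev G Y.
Proof. exact: map_mxM. Qed.

Lemma ev_scalar (p : gl_poly K n) Y : ev (p%:M : polymap K n m) Y = (p.@[mxvec Y 0])%:M.
Proof. exact: map_scalar_mx. Qed.

(** The directional derivative of [F] at [Y] along [Z]. *)
Definition dev F Y Z : 'M[K]_(dimV n m) :=
  \sum_k mxvec Z 0 k *: ev (map_mx (mderiv k) F) Y.

Lemma dev_linear F Y : linear (dev F Y).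
Proof.
move=> c Z Z'; rewrite scaler_sumr -big_split; apply: eq_bigr => k _ /=.
by rewrite linearP !mxE scalerDl scalerA.
Qed.

HB.instance Definition _ F Y := GRing.isLinear.Build K _ _ _ (dev F Y) (dev_linear F Y).

Lemma dev_delta F Y i j :
  dev F Y (delta_mx i j) = ev (map_mx (mderiv (mxvec_index i j)) F) Y.
Proof.
rewrite /dev (bigD1 (mxvec_index i j)) //= mxvec_delta mxE !eqxx scale1r big1 ?addr0 //.
by move=> k /negbTE kij; rewrite mxE kij andbF scale0r.
Qed.

(** The operator as a contraction of the Casimir tensor with the derivative of [F] and [gl_rep], the
    form to which [casimir_conj] applies. *)
Lemma ev_KW F Y : ev (KW F) Y =
  \sum_i \sum_j dev F Y (delta_mx j i) *m gl_rep m (delta_mx i j).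
Proof.
have E (G : 'M[K]_(dimV n m)) :
    map_mx (meval (mxvec Y 0)) (map_mx (@mpolyC (n * n) K) G) = G.
  by apply/matrixP => a b; rewrite 2!mxE mevalC.
rewrite /ev /KW map_mx_sum; apply: eq_bigr => i _; rewrite map_mx_sum.
by apply: eq_bigr => j _; rewrite map_mxM dev_delta E.
Qed.

Lemma tang_ev F Y Z : tang (fun s => ev F (Y + s *: Z)) (ev F Y) (dev F Y Z).
Proof.
apply: tang_mx => a b.
apply: tang_ext (tang_meval (F a b) (mxvec Y 0) (mxvec Z 0)) => [s||].
- by rewrite !mxE; apply: meval_eq => k; rewrite linearD linearZ !mxE.
- by rewrite mxE.
- by rewrite summxE; apply: eq_bigr => k _; rewrite !mxE mulrC.
Qed.

(** Differentiate the equivariance in [Y], with [g] fixed. *)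
Lemma kirillov_dev F g Y Z : kirillov F -> g \in unitmx ->
  dev F (g *m Y *m invmx g) (g *m Z *m invmx g) =
  GL_rep m g *m dev F Y Z *m GL_rep m (invmx g).
Proof.
move=> kF gu.
have h := tang_mulmx (tang_mulmx (tang_cst (GL_rep m g)) (tang_ev F Y Z))
            (tang_cst (GL_rep m (invmx g))).
have [s|_] := tang_mx_uniq (tang_ev F (g *m Y *m invmx g) (g *m Z *m invmx g)) h.
  by rewrite -kF //; congr ev; rewrite mulmxDr mulmxDl -scalemxAr -scalemxAl.
by move->; rewrite mulmx0 mul0mx addr0 add0r.
Qed.

(** Conjugating by [g] conjugates both factors of each summand, hence both legs of the Casimir
    tensor, which is invariant. *)
Lemma kirillov_KW F : kirillov F -> kirillov (KW F).
Proof.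
move=> kF g Y gu; have gVu : invmx g \in unitmx by rewrite unitmx_inv.
rewrite !ev_KW -[in RHS](casimir_conj (dev F Y) (gl_rep m) gu).
rewrite mulmx_sumr mulmx_suml; apply: eq_bigr => i _.
rewrite mulmx_sumr mulmx_suml; apply: eq_bigr => j _.
have E (Z : 'M[K]_n) : Z = g *m (invmx g *m Z *m g) *m invmx g.
  by rewrite !mulmxA mulmxV // mul1mx mulmxK.
rewrite [in LHS](E (delta_mx j i)) [in X in _ *m gl_rep m X](E (delta_mx i j)).
by rewrite (kirillov_dev _ _ kF gu) -(gl_rep_conj m _ gu) (mulmx_conj _ _ (GL_repVl m gu)).
Qed.

(** Differentiate the equivariance in [g] along [1 + s E_ji]; at a diagonal [Y] the bracket of
    [E_ji] with [Y] is a multiple of [E_ji]. *)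
Lemma kirillov_bracket F Y i j : kirillov F -> is_diag_mx Y -> i != j ->
  (Y i i - Y j j) *: dev F Y (delta_mx j i) =
  gl_rep m (delta_mx j i) *m ev F Y - ev F Y *m gl_rep m (delta_mx j i).
Proof.
move=> kF dY ij; set E := delta_mx j i.
have EE : E *m E = 0 by rewrite mul_delta_mx_0.
have EY : E *m Y = Y i i *: E.
  rewrite delta_mulmx (bigD1 i) //= big1 ?addr0 // => l li.
  by have /is_diag_mxP -> := dY; rewrite ?scale0r // eq_sym.
have YE : Y *m E = Y j j *: E.
  rewrite mulmx_delta (bigD1 j) //= big1 ?addr0 // => l li.
  by have /is_diag_mxP -> := dY; rewrite ?scale0r.
(* Since [E] squares to zero, the inverse is exactly [1 - s E], and the conjugate of [Y] is affine
   in [s]. *)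
have gg s : (1%:M + s *: E) *m (1%:M - s *: E) = 1%:M.
  rewrite mulmxDl mul1mx mulmxBr mulmx1 -scalemxAl -scalemxAr EE !scaler0 subr0.
  by rewrite subrK.
have gu s : 1%:M + s *: E \in unitmx by have [] := mulmx1_unit (gg s).
have gV s : invmx (1%:M + s *: E) = 1%:M - s *: E.
  by rewrite -[RHS](mulKmx (gu s)) gg mulmx1.
have h1 := tang_mulmx (tang_ev F Y ((Y i i - Y j j) *: E)) (tang_GL_rep m E).
have h2 := tang_mulmx (tang_GL_rep m E) (tang_cst (ev F Y)).
have [s|_] := tang_mx_uniq h1 h2.
  (* Equivariance enters as [F(g Y g^-1) GL(g) = GL(g) F(Y)], so that no inverse of [GL_rep] has to
     be expanded. *)
  rewrite -[RHS]mulmx1 -(GL_repVl m (gu s)) [RHS]mulmxA -(kF _ _ (gu s)).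
  congr (ev F _ *m _); rewrite gV mulmxDl mul1mx mulmxBr mulmx1 mulmxDl.
  rewrite -!scalemxAl -!scalemxAr EY YE -scalemxAl EE !scaler0 addr0.
  by rewrite scalerBl scalerBr -addrA; congr (_ + _); rewrite scalerA mulrC -scalerA addrC.
by rewrite linearZ /= mulmx1 mulmx0 add0r => <-; rewrite [X in _ = X - _]addrC addrK.
Qed.

Lemma kirillov_comm F Y g : kirillov F -> g \in unitmx -> g *m Y = Y *m g ->
  ev F Y *m GL_rep m g = GL_rep m g *m ev F Y.
Proof.
move=> kF gu gY; have e : g *m Y *m invmx g = Y by rewrite gY mulmxK.
have := kF g Y gu; rewrite e; exact: mulmx_comm_conj (GL_repVl m gu).
Qed.

(** Diagonal [g] commute with [Y], so [F(Y)] commutes with the torus, whose weights on the monomials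
    are pairwise distinct. *)
Lemma kirillov_diag F Y : kirillov F -> is_diag_mx Y -> is_diag_mx (ev F Y).
Proof.
move=> kF dY; apply/is_diag_mxP => a b ab.
(* [g k] scales the monomial of exponent [mu] by [2 ^+ mu k]; together these scalars determine
   [mu]. *)
pose g (k : 'I_n) : 'M[K]_n := diag_mx (\row_i (2 ^+ (i == k))).
have dg k : is_diag_mx (g k) by exact: diag_mx_is_diag.
have gu k : g k \in unitmx.
  rewrite unitmxE det_diag unitfE prodf_seq_neq0; apply/allP => i _ /=.
  by rewrite mxE expf_neq0 // pnatr_eq0.
apply: contraNeq ab => Fab; suff -> : a = b by []; apply/eqP; rewrite -enum_wt_eq; apply/eqP/mnmP => k.
have /diag_mxP[d eY] := dY.
have : ev F Y *m GL_rep m (g k) = GL_rep m (g k) *m ev F Y.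
  by apply: (kirillov_comm kF (gu k)); rewrite eY diag_mxC.
move: (ev F Y) Fab => A Aab; rewrite GL_rep_diag // mul_mx_diag mul_diag_mx.
move/matrixP => /(_ a b); rewrite !mxE [X in _ = X]mulrC => /(mulfI Aab).
have E (c : 'I_(dimV n m)) :
    \prod_i g k i i ^+ (enum_val c : wt n m) i = 2 ^+ (enum_val c : wt n m) k.
  rewrite (bigD1 k) //= big1 => [|i /negbTE ik]; rewrite !mxE eqxx mulr1n ?eqxx ?mulr1 //.
  by rewrite ik expr1n.
rewrite !E => /eqP; rewrite -!natrX eqr_nat eqn_exp2l // => /eqP ->.
by [].
Qed.

(** Testing on the diagonal matrix units [E_kk] recovers each exponent, so a weight vector is
    supported on one monomial. *)
Lemma weight_spaceP (a : 'I_(dimV n m)) (v : 'cV[K]_(dimV n m)) :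
  weight_space (enum_val a) v <-> exists c, v = c *: delta_mx a 0.
Proof.
split=> [wv|[c ->] H dH]; last first.
  rewrite gl_rep_diag // -scalemxAr mul_diag_mx scalerA mulrC -scalerA; congr (_ *: _).
  apply/matrixP => b j; rewrite !mxE.
  by case: eqP => [->|]; rewrite ?mulr0.
exists (v a 0); apply/matrixP => b j; rewrite ord1 !mxE eqxx andbT.
have [->|ba] := eqVneq b a; first by rewrite mulr1.
rewrite mulr0; apply: contraNeq ba => vb0; rewrite -enum_wt_eq; apply/eqP/mnmP => k.
have dk : is_diag_mx (delta_mx k k : 'M[K]_n).
  apply/is_diag_mxP => i l il; rewrite mxE; apply/eqP; rewrite pnatr_eq0 eqb0.
  by apply: contra il => /andP[/eqP-> /eqP->].
have := wv _ dk; rewrite gl_rep_diag // mul_diag_mx => /matrixP/(_ b 0).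
rewrite !mxE => /(mulIf vb0).
have E (c : 'I_(dimV n m)) : \sum_i ((enum_val c : wt n m) i)%:R * (delta_mx k k : 'M[K]_n) i i
    = ((enum_val c : wt n m) k)%:R.
  rewrite (bigD1 k) //= big1 => [|i /negbTE ik]; rewrite !mxE ?eqxx ?mulr1 ?addr0 //.
  by rewrite ik mulr0.
by rewrite !E => /eqP; rewrite eqr_nat => /eqP ->.
Qed.

Lemma hatP F (phi : wtfun K n m) : hat F phi <-> forall Y, is_diag_mx Y ->
  ev F Y = diag_mx (\row_a (phi (enum_val a)).@[fun i => Y i i]).
Proof.
split=> h Y dY => [|mu v].
  apply/matrixP => a b; rewrite !mxE.
  have wb : weight_space (enum_val b) (delta_mx b 0 : 'cV[K]_(dimV n m)).
    by apply/weight_spaceP; exists 1; rewrite scale1r.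
  have /matrixP/(_ a 0) := h Y dY _ _ wb; rewrite -colE !mxE eqxx andbT => ->.
  by case: eqP => [->|]; rewrite ?mulr1 ?mulr0.
rewrite -(enum_rankK mu) => /weight_spaceP[c ->]; rewrite h // mul_diag_mx.
apply/matrixP => a b; rewrite !mxE; case: eqP => [->|]; rewrite ?mulr0 //.
Qed.

Lemma hat_uniq F (phi psi : wtfun K n m) : hat F phi -> hat F psi -> phi = psi.
Proof.
move=> /hatP h1 /hatP h2; apply/ffunP => mu; apply/eqP; rewrite -subr_eq0.
apply/eqP/meval_eq0 => v; pose Y : 'M[K]_n := diag_mx (\row_i v i).
have dY : is_diag_mx Y := diag_mx_is_diag _.
have := h1 Y dY; rewrite h2 // => /matrixP/(_ (enum_rank mu) (enum_rank mu)).
rewrite !mxE eqxx !mulr1n !enum_rankK mevalB => /eqP; rewrite eq_sym -subr_eq0 => /eqP.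
have E p : p.@[fun i => Y i i] = p.@[v].
  by apply: meval_eq => i; rewrite !mxE eqxx mulr1n.
by rewrite !E.
Qed.

(** The restriction from S(gl_n) to S(h) of coordinate polynomials: [y_ii] becomes ['X_i] and the
    other [y_ij] become zero. *)
Definition diag_restr : {mpoly K[n * n]} -> {mpoly K[n]} :=
  comp_mpoly [tuple mxvec (diag_mx (\row_(i < n) ('X_i : {mpoly K[n]}))) 0 k | k < n * n].

Lemma diag_restrC c : diag_restr c%:MP = c%:MP.
Proof. exact: comp_mpolyC. Qed.

Lemma diag_restrD p q : diag_restr (p + q) = diag_restr p + diag_restr q.
Proof. exact: comp_mpolyD. Qed.

Lemma diag_restrM p q : diag_restr (p * q) = diag_restr p * diag_restr q.
Proof. exact: rmorphM. Qed.

Lemma diag_restrE p Y : is_diag_mx Y ->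
  (diag_restr p).@[fun i => Y i i] = p.@[mxvec Y 0].
Proof.
move=> dY; rewrite /diag_restr comp_mpoly_meval; apply: meval_eq => k.
rewrite tnth_mktuple; case/mxvec_indexP: k => i j; rewrite !mxvecE !mxE.
have [->|ij] := eqVneq i j; first by rewrite mulr1n mevalXU.
by rewrite mulr0n meval0; have /is_diag_mxP -> := dY.
Qed.

Lemma kirillov_hat F : kirillov F ->
  hat F [ffun mu => diag_restr (F (enum_rank mu) (enum_rank mu))].
Proof.
move=> kF; apply/hatP => Y dY; apply/matrixP => a b.
have [<-|ab] := eqVneq a b.
  by rewrite !mxE eqxx mulr1n ffunE enum_valK diag_restrE.
by have /is_diag_mxP -> := kirillov_diag kF dY; rewrite // !mxE (negbTE ab).
Qed.

Lemma kirillovD F G : kirillov F -> kirillov G -> kirillov (F + G).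
Proof. by move=> kF kG g Y gu; rewrite !evD kF // kG // mulmxDr mulmxDl. Qed.

Lemma kirillovM F G : kirillov F -> kirillov G -> kirillov (F *m G).
Proof.
move=> kF kG g Y gu; by rewrite !evM (kF _ _ gu) (kG _ _ gu) (mulmx_conj _ _ (GL_repVl m gu)).
Qed.

Lemma kirillov_scalar (p : gl_poly K n) :
  (forall g Y, g \in unitmx -> p.@[mxvec (g *m Y *m invmx g) 0] = p.@[mxvec Y 0]) ->
  kirillov (p%:M : polymap K n m).
Proof.
move=> hp g Y gu; rewrite !ev_scalar hp // -scalemx1 -scalemxAr mulmx1 -scalemxAl.
by rewrite (GL_repV m gu).
Qed.

Lemma hatD F G (phi psi : wtfun K n m) : hat F phi -> hat G psi ->
  hat (F + G) [ffun mu => phi mu + psi mu].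
Proof.
move=> /hatP h1 /hatP h2; apply/hatP => Y dY; rewrite evD h1 // h2 // -linearD.
by congr diag_mx; apply/rowP => a; rewrite !mxE ffunE mevalD.
Qed.

Lemma hatM F G (phi psi : wtfun K n m) : hat F phi -> hat G psi ->
  hat (F *m G) [ffun mu => phi mu * psi mu].
Proof.
move=> /hatP h1 /hatP h2; apply/hatP => Y dY; rewrite evM h1 // h2 // mulmx_diag.
by congr diag_mx; apply/rowP => a; rewrite !mxE ffunE mevalM.
Qed.

Lemma hat_scalar (p : gl_poly K n) :
  hat (p%:M : polymap K n m) [ffun=> diag_restr p].
Proof.
apply/hatP => Y dY; rewrite ev_scalar -diag_const_mx; congr diag_mx.
by apply/rowP => a; rewrite !mxE ffunE diag_restrE.
Qed.
End Kirillov.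

(** * Density of diagonalizable matrices *)

Section Density.
Variables (C : numClosedFieldType) (n : nat).
Implicit Types (Y : 'M[C]_n).

Lemma meval_line (k : nat) (p : {mpoly C[k]}) (x y : 'I_k -> C) :
  exists P : {poly C}, forall s, P.[s] = p.@[fun i => x i + s * y i].
Proof.
elim/mpoly_alg_ind: p => [c|i|p q [P hP] [Q hQ]|p q [P hP] [Q hQ]].
- by exists c%:P => s; rewrite hornerC mevalC.
- by exists ((x i)%:P + y i *: 'X) => s; rewrite !hornerE mevalXU mulrC.
- by exists (P + Q) => s; rewrite hornerD mevalD hP hQ.
- by exists (P * Q) => s; rewrite hornerM mevalM hP hQ.
Qed.

(** The characteristic polynomial splits over the diagonal entries; as these are distinct, the
    minimal polynomial, which divides it, has simple roots. *)
Lemma trig_diagonalizable Y : is_trig_mx Y -> injective (fun i => Y i i) ->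
  exists2 g, g \in unitmx & exists d, Y = g *m diag_mx d *m invmx g.
Proof.
case: n Y => [|k] Y tY iY.
  by exists 1%:M; rewrite ?unitmx1 //; exists 0; apply/matrixP => -[].
have [P Pu PY] : diagonalizable Y.
  apply/diagonalizableP; exists [seq Y i i | i <- enum 'I_k.+1].
    by rewrite map_inj_uniq ?enum_uniq.
  rewrite big_map big_enum -(char_poly_trig tY); exact: mxminpoly_dvd_char.
exists (invmx P); first by rewrite unitmx_inv.
have /diag_mxP[d ed] := PY; exists d; rewrite -ed conjumx // invmxK.
by rewrite !mulmxA mulVmx // mul1mx mulmxKV.
Qed.

(* Over a closed field, [Y] is conjugate to a triangular [T], and [T + s D] is
   diagonalizable for all but finitely many [s] when [D] has distinct diagonal
   entries. *)
Lemma meval_diagonalizable_eq0 (p : gl_poly C n) : (0 < n)%N ->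
  (forall g d, g \in unitmx -> p.@[mxvec (g *m diag_mx d *m invmx g) 0] = 0) -> p = 0.
Proof.
move=> n0 hp; apply: meval_eq0 => v; pose Y := vec_mx (\row_k v k).
suff : p.@[mxvec Y 0] = 0.
  by move=> <-; apply: meval_eq => k; rewrite vec_mxK mxE.
have [P /unitarymx_unit Pu tY] := Schur Y n0.
have [T tT eY] : exists2 T, is_trig_mx T & Y = invmx P *m T *m P.
  by exists (conjmx P Y) => //; rewrite conjumx // !mulmxA mulVmx // mul1mx mulmxKV.
pose D : 'M[C]_n := diag_mx (\row_i (i : nat)%:R).
have [L hL] := meval_line p (mxvec Y 0) (mxvec (invmx P *m D *m P) 0).
(* [Q] vanishes at [s] exactly when two diagonal entries of [T + s D] coincide. The restriction [L]
   of [p] to the line vanishes elsewhere, so [L * Q = 0], and [L] at 0 is the value sought. *)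
pose Q : {poly C} := \prod_(i < n) \prod_(j < n | i != j)
  ((T i i - T j j)%:P + ((i : nat)%:R - (j : nat)%:R) *: 'X).
have Q0 : Q != 0.
  apply/prodf_neq0 => i _; apply/prodf_neq0 => j ij; apply: contraNneq ij.
  move=> /(congr1 (fun q : {poly C} => q`_1)).
  rewrite coefD coefC coefZ coefX coef0 /= add0r mulr1 => /eqP.
  by rewrite subr_eq0 eqr_nat.
suff /eqP : L * Q = 0.
  rewrite mulf_eq0 (negbTE Q0) orbF => /eqP L0.
  have := hL 0; rewrite L0 horner0 => ->.
  by apply: meval_eq => k; rewrite mul0r addr0.
apply: horner_eq0 => s; rewrite hornerM.
have [->|Qs] := eqVneq Q.[s] 0; first by rewrite mulr0.
have tr : is_trig_mx (T + s *: D).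
  apply/is_trig_mxP => i j ij; rewrite !mxE; have /is_trig_mxP -> // := tT.
  rewrite (_ : (i == j) = false) ?mulr0n ?mulr0 ?addr0 //.
  by apply/negbTE; rewrite neq_ltn ij.
have inj : injective (fun i => (T + s *: D) i i).
  move=> i j /eqP; apply: contraTeq => ij; rewrite !mxE !eqxx !mulr1n.
  move: Qs; rewrite horner_prod => /prodf_neq0/(_ i isT).
  rewrite horner_prod => /prodf_neq0/(_ j ij); rewrite !hornerE; apply: contra.
  move=> /eqP e; apply/eqP.
  transitivity ((T i i + s * (i : nat)%:R) - (T j j + s * (j : nat)%:R)); first by ring.
  by rewrite e subrr.
have [g gu [d ed]] := trig_diagonalizable tr inj.
have gPu : invmx P *m g \in unitmx by rewrite unitmx_mul unitmx_inv Pu.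
rewrite hL (_ : _.@[_] = 0) ?mul0r // -[RHS](hp _ d gPu); apply: meval_eq => k.
have eV : invmx (invmx P *m g) = invmx g *m P.
  have e : (invmx P *m g) *m (invmx g *m P) = 1%:M by rewrite mulmxA mulmxK // mulVmx.
  by rewrite -[RHS](mulKmx gPu) e mulmx1.
have -> : invmx P *m g *m diag_mx d *m invmx (invmx P *m g) = Y + s *: (invmx P *m D *m P).
  rewrite eV mulmxA -[_ *m diag_mx d]mulmxA -[_ *m invmx g]mulmxA -ed mulmxDr mulmxDl.
  by rewrite -scalemxAr -scalemxAl eY.
by rewrite linearD linearZ !mxE.
Qed.

Lemma kirillov_eq m (F G : polymap C n m) : (0 < n)%N -> kirillov F -> kirillov G ->
  (forall Y, is_diag_mx Y -> ev F Y = ev G Y) -> F = G.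
Proof.
move=> n0 kF kG e; apply/matrixP => a b; apply/eqP; rewrite -subr_eq0; apply/eqP.
apply: meval_diagonalizable_eq0 => // g d gu; rewrite mevalB.
have := e _ (diag_mx_is_diag d).
move=> /(congr1 (fun A => GL_rep m g *m A *m GL_rep m (invmx g))).
rewrite -(kF _ _ gu) -(kG _ _ gu) => /matrixP/(_ a b).
by rewrite /ev !mxE => ->; rewrite subrr.
Qed.

Lemma hat_inj m (F G : polymap C n m) phi : (0 < n)%N -> kirillov F -> kirillov G ->
  hat F phi -> hat G phi -> F = G.
Proof.
move=> n0 kF kG /hatP hF /hatP hG; apply: kirillov_eq => // Y dY.
by rewrite hF // hG.
Qed.
End Density.

(** * Sums of principal minors *)

Section PrincipalMinors.
Variables (R : comNzRingType).

(** The two signs of the permutation cancel. The sizes are linked by an equation because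
    [#|S| + #|~: S|] equals [n] only propositionally. *)
Lemma det_mxsub_inj p n (f : 'I_p -> 'I_n) (A : 'M[R]_n) : p = n -> injective f ->
  \det (mxsub f f A) = \det A.
Proof.
move=> epn; case: _ / epn in A f * => fi.
have -> : mxsub f f A = row_perm (perm fi) (col_perm (perm fi) A).
  by apply/matrixP => i j; rewrite !mxE !permE.
by rewrite row_permE col_permE !det_mulmx !det_perm odd_permV mulrC -mulrA -signr_addb addbb mulr1.
Qed.

Variables (n : nat).
Implicit Types (S : {set 'I_n}) (Y : 'M[R]_n).

Definition minor Y S : R := \det (mxsub (@enum_val _ (mem S)) (@enum_val _ (mem S)) Y).

(** Listing the indices of [S] first makes the matrix block upper triangular, with a scalar lower
    block. *)
Lemma det_minor Y S x :
  \det (\matrix_(i, j) if i \in S then Y i j else x *+ (i == j)) =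
  x ^+ (n - #|S|) * minor Y S.
Proof.
pose f (k : 'I_(#|S| + #|~: S|)) : 'I_n :=
  match split k with inl a => enum_val a | inr b => enum_val b end.
have fi : injective f.
  move=> k l; rewrite -[k]splitK -[l]splitK /f !unsplitK.
  case: (split k) => a; case: (split l) => b.
  - by move/enum_val_inj->.
  - by move=> e; have := enum_valP b; rewrite -e inE enum_valP.
  - by move=> e; have := enum_valP a; rewrite e inE enum_valP.
  - by move/enum_val_inj->.
have dim : (#|S| + #|~: S|)%N = n by rewrite cardsC card_ord.
rewrite -(det_mxsub_inj _ dim fi).
have -> : (n - #|S| = #|~: S|)%N by have := dim; lia.
rewrite mulrC -det_scalar -(det_ublock _
  (\matrix_(a < #|S|, b < #|~: S|) Y (enum_val a) (enum_val b))); congr (\det _).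
apply/matrixP => k l; rewrite mxE mxE -[k]splitK -[l]splitK /f !unsplitK.
case: (split k) => a; case: (split l) => b /=.
- by rewrite enum_valP block_mxEul mxE.
- by rewrite enum_valP block_mxEur mxE.
- have aS : enum_val a \notin S by have := enum_valP a; rewrite inE.
  rewrite (negbTE aS) block_mxEdl mxE.
  by case: eqP => // e; rewrite e enum_valP in aS.
- have aS : enum_val a \notin S by have := enum_valP a; rewrite inE.
  by rewrite (negbTE aS) block_mxEdr mxE (inj_eq enum_val_inj).
Qed.

(** Multilinearity in the rows: [S] is the set of rows from which the [Y] part is taken. *)
Lemma det_scalar_add Y x :
  \det (x%:M + Y) = \sum_(S : {set 'I_n}) x ^+ (n - #|S|) * minor Y S.
Proof.
under [RHS]eq_bigr => S _ do rewrite -det_minor.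
rewrite exchange_big /=; apply: eq_bigr => s _; rewrite -mulr_sumr; congr (_ * _).
under eq_bigr => i _ do rewrite !mxE addrC.
rewrite bigA_distr; apply: eq_big => // S _.
by apply: eq_bigr => i _; rewrite mxE; case: ifP.
Qed.
End PrincipalMinors.

(** * The [c_k] as invariant polynomials, and their restriction to diagonal matrices *)

Section Invariants.
Variables (K : numFieldType) (n m : nat).

Lemma minor_map (R R' : comNzRingType) (f : {rmorphism R -> R'}) (Y : 'M[R]_n) S :
  minor (map_mx f Y) S = f (minor Y S).
Proof. by rewrite /minor -det_map_mx; congr (\det _); apply/matrixP => i j; rewrite !mxE. Qed.

Lemma c_minor k : c_ K n k = \sum_(S : {set 'I_n} | #|S| == k) minor (generic_gl K n) S.
Proof.
apply: eq_bigr => S _; rewrite /principal_minor /minor.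
by congr (\det _); apply/matrixP => i j; rewrite !mxE.
Qed.

Lemma c_eval k (Y : 'M[K]_n) :
  (c_ K n k).@[mxvec Y 0] = \sum_(S : {set 'I_n} | #|S| == k) minor Y S.
Proof.
rewrite c_minor raddf_sum; apply: eq_bigr => S _ /=.
rewrite -(minor_map (meval (mxvec Y 0))).
by congr (minor _ _); apply/matrixP => i j; rewrite 2!mxE /= mevalXU mxvecE.
Qed.

(** Conjugation invariance of [c_k] will follow from that of this determinant. *)
Lemma c_charpoly k (Y : 'M[K]_n) : (k <= n)%N ->
  (c_ K n k).@[mxvec Y 0] = (\det ('X%:M + map_mx polyC Y))`_(n - k).
Proof.
move=> kn; rewrite c_eval det_scalar_add coef_sum big_mkcond /=; apply: eq_bigr => S _.
rewrite (minor_map polyC) coefXnM coefC.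
have [e|Sk] := eqVneq #|S| k; first by rewrite e ltnn subnn.
have Sn : (#|S| <= n)%N by rewrite -[X in (_ <= X)%N]card_ord max_card.
case: ltnP => // le; rewrite subn_eq0 leqNgt ltn_neqAle le andbT.
by have -> : (n - #|S| != n - k)%N by apply: contra Sk; lia.
Qed.

Lemma c_invariant k (g Y : 'M[K]_n) : (k <= n)%N -> g \in unitmx ->
  (c_ K n k).@[mxvec (g *m Y *m invmx g) 0] = (c_ K n k).@[mxvec Y 0].
Proof.
move=> kn gu; rewrite !c_charpoly //; congr (_ `_ _).
have gV : map_mx polyC g *m map_mx polyC (invmx g) = 1%:M.
  by rewrite -map_mxM mulmxV // map_mx1.
have -> : 'X%:M + map_mx polyC (g *m Y *m invmx g)
  = map_mx polyC g *m ('X%:M + map_mx polyC Y) *m map_mx polyC (invmx g).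
  rewrite mulmxDr mulmxDl -!map_mxM; congr (_ + _).
  by rewrite scalar_mxC -mulmxA gV mulmx1.
by rewrite !det_mulmx mulrAC -det_mulmx gV det1 mul1r.
Qed.

Lemma c_diag k : diag_restr (c_ K n k) = mesym n K k.
Proof.
apply/eqP; rewrite -subr_eq0; apply/eqP/meval_eq0 => v.
pose Y : 'M[K]_n := diag_mx (\row_i v i).
have E p : p.@[fun i => Y i i] = p.@[v].
  by apply: meval_eq => i; rewrite !mxE eqxx mulr1n.
rewrite mevalB; apply/eqP; rewrite subr_eq0; apply/eqP.
rewrite -E diag_restrE ?diag_mx_is_diag // c_eval raddf_sum /=.
apply: eq_bigr => S _.
rewrite rmorph_prod /minor /=.
have -> : mxsub (@enum_val _ (mem S)) (@enum_val _ (mem S)) Y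
  = diag_mx (\row_a v (enum_val a)).
  by apply/matrixP => a b; rewrite !mxE (inj_eq enum_val_inj).
rewrite det_diag [RHS]big_enum_val; apply: eq_bigr => a _.
by rewrite mxE /= mevalXU.
Qed.

Lemma kirillov_c k : (k <= n)%N -> kirillov ((c_ K n k)%:M : polymap K n m).
Proof. by move=> kn; apply: kirillov_scalar => g Y; apply: c_invariant. Qed.

Lemma hat_c k : hat ((c_ K n k)%:M : polymap K n m) [ffun=> mesym n K k].
Proof. by rewrite -c_diag; apply: hat_scalar. Qed.
End Invariants.

(** * The Kirillov-Wei operator on diagonal matrices *)

Section KirillovWei.
Variables (K : numFieldType) (n m : nat).
Implicit Types (F : polymap K n m) (phi psi : wtfun K n m) (mu nu : wt n m).

Lemma gl_rep_delta i j (a b : 'I_(dimV n m)) :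
  gl_rep m (delta_mx i j : 'M[K]_n) a b = ((enum_val b : wt n m) j)%:R *
    ((enum_val b : wt n m) + U_(i) == (enum_val a : wt n m) + U_(j))%MM%:R.
Proof.
rewrite gl_repE (bigD1 i) //= (bigD1 j) //= mxE !eqxx mul1r big1 ?addr0 => [|l /negbTE lj].
  rewrite big1 ?addr0 // => k /negbTE ki; rewrite big1 // => l _.
  by rewrite mxE ki !mul0r.
by rewrite mxE lj andbF !mul0r.
Qed.

(** The line from [Y] in direction [E_ii] stays among diagonal matrices, where [phi] gives the
    entries of [F]. *)
Lemma dev_diag F phi (Y : 'M[K]_n) i (a : 'I_(dimV n m)) : hat F phi -> is_diag_mx Y ->
  dev F Y (delta_mx i i) a a = (phi (enum_val a))^`M(i).@[fun k => Y k k].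
Proof.
move=> /hatP hF dY; set E := delta_mx i i.
have dE s : is_diag_mx (Y + s *: E).
  apply/is_diag_mxP => k l kl; rewrite !mxE; have /is_diag_mxP -> // := dY.
  rewrite add0r; case: eqP => [ki|]; last by rewrite mulr0.
  case: eqP => [li|]; last by rewrite mulr0.
  by move: kl; rewrite ki li eqxx.
have el : linear (fun A : 'M[K]_(dimV n m) => A a a : K^o) by move=> x A B; rewrite !mxE.
have [s|_ ->] := tang_uniq (tang_lin el (tang_ev F Y E))
   (tang_meval (phi (enum_val a)) (fun k => Y k k) (fun k => E k k)).
  rewrite /= hF // !mxE eqxx mulr1n; apply: meval_eq => k.
  by rewrite !mxE.
rewrite (bigD1 i) //= big1 => [|k /negbTE ki]; rewrite !mxE ?eqxx ?mulr1 ?addr0 //.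
by rewrite ki mulr0.
Qed.

Lemma bracket_diag d (A : 'M[K]_d) (D : 'rV[K]_d) a b :
  (A *m diag_mx D - diag_mx D *m A) a b = A a b * (D 0 b - D 0 a).
Proof. by rewrite mul_mx_diag mul_diag_mx !mxE; ring. Qed.

(** The diagonal entry at [mu] of the summand [(i, j)] of [KW F], restricted to diagonal matrices.
    Being a polynomial, it shows that the divided difference is an exact quotient. *)
Definition off_term F mu i j : {mpoly K[n]} :=
  \sum_c diag_restr (F (enum_rank mu) c)^`M(mxvec_index j i) *
    (gl_rep m (delta_mx i j : 'M[K]_n) c (enum_rank mu))%:MP.

Lemma off_termE F mu i j (Y : 'M[K]_n) : is_diag_mx Y ->
  (off_term F mu i j).@[fun k => Y k k] =
  (dev F Y (delta_mx j i) *m gl_rep m (delta_mx i j)) (enum_rank mu) (enum_rank mu).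
Proof.
move=> dY; rewrite dev_delta [RHS]mxE raddf_sum; apply: eq_bigr => c _ /=.
by rewrite mevalM mevalC diag_restrE // !mxE.
Qed.

(** By [kirillov_bracket], the only path from [mu] back to [mu] passes through [nu]: [E_ij]
    contributes [mu j], and [E_ji] contributes [nu i], which is [(mu i).+1]. *)
Lemma off_term_mul F phi mu nu i j : kirillov F -> hat F phi -> i != j ->
  (nu + U_(j) = mu + U_(i))%MM ->
  ('X_i - 'X_j) * off_term F mu i j = (mu j * (mu i).+1)%:R *: (phi nu - phi mu).
Proof.
move=> kF hF ij enu; apply/eqP; rewrite -subr_eq0; apply/eqP/meval_eq0 => v.
pose Y : 'M[K]_n := diag_mx (\row_k v k).
have dY : is_diag_mx Y := diag_mx_is_diag _.
have E p : p.@[fun k => Y k k] = p.@[v].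
  by apply: meval_eq => k; rewrite !mxE eqxx mulr1n.
rewrite -E mevalB mevalM mevalB !mevalXU off_termE //; clearbody Y.
have -> : forall A B : 'M[K]_(dimV n m), (Y i i - Y j j) * (A *m B) (enum_rank mu) (enum_rank mu)
    = ((((Y i i - Y j j) *: A) *m B) (enum_rank mu) (enum_rank mu)).
  by move=> A B; rewrite -scalemxAl [RHS]mxE.
rewrite (kirillov_bracket kF dY ij) ((hatP F phi).1 hF Y dY) mxE.
under eq_bigr => c _ do rewrite bracket_diag.
rewrite (bigD1 (enum_rank nu)) //= big1 => [|c cnu]; last first.
  rewrite gl_rep_delta enum_rankK; case: eqP => [e|_]; last by rewrite !(mulr0, mul0r).
  case/eqP: cnu; apply: enum_val_inj; rewrite enum_rankK; apply: wt_inj.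
  by apply: (@addIm _ U_(j)%MM); rewrite e enu.
rewrite addr0 !gl_rep_delta ![(\row_a _) _ _]mxE !enum_rankK enu eqxx !mulr1.
rewrite mevalZ mevalB natrM.
have -> : nu i = (mu i).+1.
  have := congr1 (fun k : 'X_{1..n} => k i) enu; rewrite !mnmDE !mnm1E eqxx eq_sym.
  by rewrite (negbTE ij) addn0 addn1.
by ring.
Qed.

Lemma off_term0 F mu i j : mu j = 0%N -> off_term F mu i j = 0.
Proof.
move=> mu0; rewrite /off_term big1 // => c _.
by rewrite gl_rep_delta enum_rankK mu0 mul0r mpolyC0 mulr0.
Qed.

Lemma hat_KW F phi psi mu : hat F phi -> hat (KW F) psi ->
  psi mu = \sum_(i < n) (mu i)%:R *: (phi mu)^`M(i)
           + \sum_(i < n) \sum_(j < n | i != j) off_term F mu i j.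
Proof.
move=> hF /hatP hG; apply/eqP; rewrite -subr_eq0; apply/eqP/meval_eq0 => v.
pose Y : 'M[K]_n := diag_mx (\row_k v k).
have dY : is_diag_mx Y := diag_mx_is_diag _.
have E p : p.@[fun k => Y k k] = p.@[v].
  by apply: meval_eq => k; rewrite !mxE eqxx mulr1n.
rewrite -E; clearbody Y.
have e : (psi mu).@[fun k => Y k k] = ev (KW F) Y (enum_rank mu) (enum_rank mu).
  by rewrite hG // !mxE eqxx mulr1n enum_rankK.
rewrite mevalB e ev_KW mevalD !raddf_sum /= summxE -big_split /=.
apply/eqP; rewrite subr_eq0; apply/eqP; apply: eq_bigr => i _.
rewrite summxE (bigD1 i) //=; congr (_ + _).
  have dE : is_diag_mx (delta_mx i i : 'M[K]_n).
    apply/is_diag_mxP => k l kl; rewrite mxE; case: eqP => // ki; case: eqP => // li.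
    by rewrite ki li eqxx in kl.
  rewrite (gl_rep_diag _ dE) mul_mx_diag mxE (dev_diag _ _ hF dY).
  rewrite enum_rankK mevalZ mulrC mxE enum_rankK; congr (_ * _).
  rewrite (bigD1 i) //= big1 => [|k /negbTE ki]; rewrite mxE ?eqxx ?mulr1 ?addr0 //.
  by rewrite ki mulr0.
rewrite raddf_sum; apply: eq_big => [j|j ji]; first by rewrite eq_sym.
by rewrite /= off_termE.
Qed.

Lemma tofrac_X_neq0 (i j : 'I_n) : i != j ->
  tofrac ('X_i - 'X_j : {mpoly K[n]}) != 0.
Proof.
move=> ij; rewrite tofrac_eq0 subr_eq0; apply: contra ij => /eqP/(congr1 (mcoeff U_(i))).
rewrite !mcoeffXU eqxx eq_sym => /eqP; rewrite eqr_nat eq_sym.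
by case: (i == j).
Qed.

(** [Phi] takes arbitrary coefficient functions because [mu + e_i - e_j] may fail to be a weight;
    its compatibility with pointwise equality identifies the shifted function with a weight when
    there is one. *)
Lemma KW_formula F (Phi : ('I_n -> K) -> {mpoly K[n]}) psi mu : kirillov F ->
  (forall u v, u =1 v -> Phi u = Phi v) ->
  hat F [ffun mu : wt n m => Phi (fun l => (mu l)%:R)] -> hat (KW F) psi ->
  tofrac (psi mu) =
    tofrac (\sum_(i < n) (mu i)%:R *: (Phi (fun l => (mu l)%:R))^`M(i))
    + \sum_(i < n) \sum_(j < n | i != j)
        (mu j * (mu i).+1)%:R / tofrac ('X_i - 'X_j) *
        tofrac (Phi (fun l => (mu l)%:R + ((l == i)%:R - (l == j)%:R))
                - Phi (fun l => (mu l)%:R)).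
Proof.
move=> kF eqPhi hF hG; rewrite (hat_KW mu hF hG) ffunE rmorphD; congr (_ + _).
rewrite rmorph_sum; apply: eq_bigr => i _; rewrite rmorph_sum; apply: eq_bigr => j ij /=.
have Xij : tofrac ('X_i - 'X_j : {mpoly K[n]}) != 0 := tofrac_X_neq0 ij.
(* For [mu j = 0] no shifted weight exists, and both sides vanish. *)
have [mu0|mu1] := eqVneq (mu j) 0%N; first by rewrite off_term0 // mu0 !mul0r rmorph0.
have muK : (mu - U_(j) + U_(j) = mu :> 'X_{1..n})%MM by rewrite submK // lep1mP.
have [nu enu] : exists nu : wt n m, (nu + U_(j) = mu + U_(i))%MM.
  have [|nu enu] := @mdeg_wt n m (mu - U_(j) + U_(i))%MM.
    by have := congr1 mdeg muK; rewrite !mdegD !mdeg1 wt_mdeg => ->.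
  by exists nu; rewrite enu -addmA [(U_(i) + _)%MM]addmC addmA muK.
have := off_term_mul kF hF ij enu.
move=> /(congr1 (@tofrac _)); rewrite tofracM => /(canRL (mulKf Xij)) ->.
rewrite !ffunE -mul_mpolyC tofracM mulrA [_^-1 * _]mulrC mpolyC_nat rmorph_nat.
congr (_ * tofrac (_ - _)); apply: eqPhi => l.
have := congr1 (fun k : 'X_{1..n} => k l) enu; rewrite !mnmDE !mnm1E => e.
apply: (addIr (l == j)%:R); rewrite [j == l]eq_sym [i == l]eq_sym in e.
by rewrite addrA subrK -!natrD e.
Qed.
End KirillovWei.

(** * Functions spanned by symmetric functions and weighted power sums *)

Section WeightedSpan.
Variables (K : numFieldType) (n : nat).
Local Notation S := {mpoly K[n]}.
Implicit Types (a : 'I_n -> K) (Phi Psi : ('I_n -> K) -> S) (s : seq nat).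

(** The plethysm of the power sum of exponent [k], with [k = 0] allowed: differentiating the case
    [k = 1] produces the sum of the [a i]. *)
Definition wpow a k : S := \sum_(i < n) a i *: 'X_i ^+ k.

Lemma psum_sym k : wpow (fun=> 1) k \is symmetric.
Proof.
apply/issymP => t; rewrite raddf_sum [RHS](reindex_inj (@perm_inj _ t)) /=.
apply: eq_bigr => i _; rewrite msymZ rmorphXn /= msymX; congr (_ *: 'X_[_] ^+ _).
by apply/mnmP => j; rewrite !mnmE -(inj_eq (@perm_inj _ t)) permKV.
Qed.

(** The span is formed for functions of an arbitrary [a], so that shifted arguments make sense;
    restriction to weights comes later, in [wt_fun]. *)
Inductive wspan : (('I_n -> K) -> S) -> Prop :=
| wspan_mon h s : h \is symmetric -> wspan (fun a => h * \prod_(k <- s) wpow a k)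
| wspan_add Phi Psi : wspan Phi -> wspan Psi -> wspan (fun a => Phi a + Psi a)
| wspan_ext Phi Psi : Phi =1 Psi -> wspan Phi -> wspan Psi.

Lemma wspan_sym (h : S) : h \is symmetric -> wspan (fun=> h).
Proof.
by move=> hs; apply: wspan_ext (wspan_mon [::] hs) => a; rewrite big_nil mulr1.
Qed.

Lemma wspan_cst c : wspan (fun=> c%:MP).
Proof. by apply: wspan_sym; apply/issymP => t; rewrite -[c%:MP]mulr1 mul_mpolyC msymZ msym1. Qed.

Lemma wspan_wpow k : wspan (wpow^~ k).
Proof.
apply: wspan_ext (wspan_mon [:: k] (rpred1 _)) => a.
by rewrite big_seq1 mul1r.
Qed.

Lemma wspan_mul Phi Psi : wspan Phi -> wspan Psi -> wspan (fun a => Phi a * Psi a).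
Proof.
move=> h1 h2; elim: h1 => {Phi} [h s hs|Phi Phi' _ IH _ IH'|Phi Phi' e _ IH].
- elim: h2 => {Psi} [h' s' hs'|Psi Psi' _ IH _ IH'|Psi Psi' e _ IH].
  + apply: wspan_ext (wspan_mon (s ++ s') (rpredM hs hs')) => a.
    by rewrite big_cat /=; ring.
  + by apply: wspan_ext (wspan_add IH IH') => a; rewrite mulrDr.
  + by apply: wspan_ext IH => a; rewrite e.
- by apply: wspan_ext (wspan_add IH IH') => a; rewrite mulrDl.
- by apply: wspan_ext IH => a; rewrite e.
Qed.

Lemma wspan_scale c Phi : wspan Phi -> wspan (fun a => c *: Phi a).
Proof.
move=> h; apply: wspan_ext (wspan_mul (wspan_cst c) h) => a.
by rewrite mul_mpolyC.
Qed.

Lemma wspan_sum (I : Type) (r : seq I) (P : pred I) (Phi : I -> ('I_n -> K) -> S) :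
  (forall i, wspan (Phi i)) -> wspan (fun a => \sum_(i <- r | P i) Phi i a).
Proof.
move=> h; elim: r => [|i r IH].
  by apply: wspan_ext (wspan_cst 0) => a; rewrite big_nil.
case Pi: (P i); last by apply: wspan_ext IH => a; rewrite big_cons Pi.
by apply: wspan_ext (wspan_add (h i) IH) => a; rewrite big_cons Pi.
Qed.

Lemma wspan_eq Phi : wspan Phi -> forall a b, a =1 b -> Phi a = Phi b.
Proof.
elim=> {Phi} [h s _|Phi Psi _ h1 _ h2|Phi Psi e _ h] a b ab.
- congr (_ * _); apply: eq_bigr => k _; apply: eq_bigr => i _.
  by rewrite ab.
- by rewrite (h1 a b) // (h2 a b).
- by rewrite -!e; apply: h.
Qed.

(** Both sides are the elementary symmetric polynomial of degree [k] in the variables other than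
    ['X_i]. *)
Lemma mesym_deriv k i :
  (mesym n K k.+1)^`M(i) = mesym n K k - 'X_i * (mesym n K k)^`M(i).
Proof.
have E (T : {set 'I_n}) : ('X_[K, mesym1 T])^`M(i) =
    if i \in T then 'X_[K, mesym1 (T :\ i)] else 0.
  rewrite mderivX mnmE; case: ifP => iT; last by rewrite scale0r.
  rewrite scale1r; congr mpolyX; apply/mnmP => j; rewrite mnmBE mnm1E !mnmE !inE.
  by rewrite eq_sym; case: eqP => [->|]; rewrite ?iT //= subn0.
have X1 (T : {set 'I_n}) : i \in T -> 'X_i * 'X_[K, mesym1 (T :\ i)] = 'X_[K, mesym1 T].
  move=> iT; rewrite -mpolyXD; congr mpolyX; apply/mnmP => j; rewrite mnmDE mnm1E !mnmE !inE.
  by rewrite eq_sym; case: eqP => [->|]; rewrite ?iT.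
rewrite !mesymE !raddf_sum mulr_sumr -sumrB /=.
under eq_bigr => T _ do rewrite E.
under [RHS]eq_bigr => T _ do rewrite E.
rewrite -big_mkcondr [RHS](bigID (fun T : {set 'I_n} => i \in T)) /=.
rewrite [X in _ = X + _]big1 ?add0r; last first.
  by move=> T /andP[_ iT]; rewrite iT X1 // subrr.
rewrite (reindex_onto (fun T => i |: T) (fun T => T :\ i)) /=; last first.
  by move=> T /andP[_ iT]; rewrite setD1K.
apply: eq_big => [T|T /andP[_ /eqP eT]]; last first.
  have iT : i \notin T by rewrite -eT !inE eqxx.
  by rewrite eT (negbTE iT) mulr0 subr0.
rewrite setU11 andbT cardsU1; apply/andP/andP => [[c /eqP e]|[/eqP <- iT]].
  have iT : i \notin T by rewrite -e !inE eqxx.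
  by move: c; rewrite iT add1n eqSS.
by rewrite iT add1n eqxx setU1K.
Qed.

(** The recursion of [mesym_deriv] creates a factor ['X_i]; the free exponent [l] absorbs it in the
    induction. *)
Lemma wspan_deriv_mesym k l :
  wspan (fun a => \sum_i a i *: ((mesym n K k)^`M(i) * 'X_i ^+ l)).
Proof.
elim: k l => [|k IH] l.
  apply: wspan_ext (wspan_cst 0) => a; rewrite big1 ?mpolyC0 // => i _.
  by rewrite mesym0E -mpolyC1 mderivC mul0r scaler0.
apply: wspan_ext (wspan_add (wspan_mul (wspan_sym (mesym_sym n K k)) (wspan_wpow l))
                    (wspan_scale (-1) (IH l.+1))) => a.
rewrite scaleN1r mulr_sumr -sumrB; apply: eq_bigr => i _.
rewrite mesym_deriv -scalerAr -scalerBr; congr (_ *: _).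
by rewrite exprS; ring.
Qed.

Lemma wspan_deriv (h : S) : h \is symmetric -> wspan (fun a => \sum_i a i *: h^`M(i)).
Proof.
move=> /sym_fundamental[t [<- _]].
have sym p : p \mPo [tuple mesym n K i.+1 | i < n] \is symmetric.
  by apply: mcomp_sym => i; rewrite -tnth_nth tnth_mktuple mesym_sym.
elim/mpoly_alg_ind: t => [c|i|p q hp hq|p q hp hq].
- apply: wspan_ext (wspan_cst 0) => a; rewrite big1 ?mpolyC0 // => i _.
  by rewrite comp_mpolyC mderivC scaler0.
- apply: wspan_ext (wspan_deriv_mesym i.+1 0) => a; apply: eq_bigr => j _.
  by rewrite comp_mpolyXU -tnth_nth tnth_mktuple expr0 mulr1.
- apply: wspan_ext (wspan_add hp hq) => a; rewrite -big_split; apply: eq_bigr => i _ /=.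
  by rewrite comp_mpolyD mderivD scalerDr.
- apply: wspan_ext (wspan_add (wspan_mul (wspan_sym (sym q)) hp)
                              (wspan_mul (wspan_sym (sym p)) hq)) => a.
  rewrite !mulr_sumr -big_split; apply: eq_bigr => i _ /=.
  by rewrite rmorphM mderivM -!scalerAr -scalerDr; congr (_ *: _); ring.
Qed.

(** Polynomials in ['X_i] and ['X_j] with coefficients in the span, uniformly in [i] and [j], so
    that double sums over all pairs factor. *)
Inductive wspan2 : ('I_n -> 'I_n -> ('I_n -> K) -> S) -> Prop :=
| wspan2_mon Phi k l : wspan Phi -> wspan2 (fun i j a => Phi a * ('X_i ^+ k * 'X_j ^+ l))
| wspan2_add G H : wspan2 G -> wspan2 H -> wspan2 (fun i j a => G i j a + H i j a)
| wspan2_ext G H : (forall i j, G i j =1 H i j) -> wspan2 G -> wspan2 H.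

Lemma wspan2_mul Phi k l G : wspan Phi -> wspan2 G ->
  wspan2 (fun i j a => Phi a * ('X_i ^+ k * 'X_j ^+ l) * G i j a).
Proof.
move=> hPhi; elim=> {G} [Psi k' l' h|G H _ h _ h'|G H e _ h].
- apply: wspan2_ext (wspan2_mon (k + k') (l + l') (wspan_mul hPhi h)) => i j a.
  by rewrite !exprD; ring.
- by apply: wspan2_ext (wspan2_add h h') => i j a; rewrite mulrDr.
- by apply: wspan2_ext h => i j a; rewrite e.
Qed.

Lemma wspan2_sum G : wspan2 G ->
  wspan (fun a => \sum_i \sum_j (a j * (a i + 1)) *: G i j a).
Proof.
elim=> {G} [Phi k l h|G H _ h _ h'|G H e _ h].
- have hk : wspan (fun a => wpow a k + wpow (fun=> 1) k).
    exact: wspan_add (wspan_wpow k) (wspan_sym (psum_sym k)).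
  apply: wspan_ext (wspan_mul h (wspan_mul hk (wspan_wpow l))) => a.
  rewrite -big_split mulr_suml mulr_sumr; apply: eq_bigr => i _ /=.
  rewrite !mulr_sumr; apply: eq_bigr => j _.
  by rewrite -!mul_mpolyC mpolyCM mpolyCD; ring.
- apply: wspan_ext (wspan_add h h') => a; rewrite -big_split; apply: eq_bigr => i _ /=.
  by rewrite -big_split; apply: eq_bigr => j _ /=; rewrite scalerDr.
- by apply: wspan_ext h => a; apply: eq_bigr => i _; apply: eq_bigr => j _; rewrite e.
Qed.

Lemma wspan2_diag G : wspan2 G -> wspan (fun a => \sum_i a i *: G i i a).
Proof.
elim=> {G} [Phi k l h|G H _ h _ h'|G H e _ h].
- apply: wspan_ext (wspan_mul h (wspan_wpow (k + l))) => a.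
  by rewrite mulr_sumr; apply: eq_bigr => i _; rewrite exprD -!scalerAr.
- by apply: wspan_ext (wspan_add h h') => a; rewrite -big_split; apply: eq_bigr => i _ /=;
     rewrite scalerDr.
- by apply: wspan_ext h => a; apply: eq_bigr => i _; rewrite e.
Qed.

Definition geom (x y : S) k : S := \sum_(b < k) x ^+ (k.-1 - b) * y ^+ b.

(* [rdiff s i j a = (prod_k (wpow a k + X_i^k - X_j^k) - prod_k wpow a k) / (X_i - X_j)],
   with the division carried out so that it makes sense for [i = j] *)
Fixpoint rdiff s i j a : S :=
  if s is k :: s' then
    (wpow a k + 'X_i ^+ k - 'X_j ^+ k) * rdiff s' i j a
    + geom 'X_i 'X_j k * \prod_(l <- s') wpow a l
  else 0.

Lemma rdiffP s i j a : ('X_i - 'X_j) * rdiff s i j a =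
  \prod_(k <- s) (wpow a k + 'X_i ^+ k - 'X_j ^+ k) - \prod_(k <- s) wpow a k.
Proof.
elim: s => [|k s IH] /=; first by rewrite !big_nil mulr0 subrr.
rewrite !big_cons mulrDr [LHS]addrC mulrA -subrXX mulrCA IH; ring.
Qed.

Lemma wpow_deriv a k i : (wpow a k)^`M(i) = (a i * k%:R) *: 'X_i ^+ k.-1.
Proof.
rewrite raddf_sum (bigD1 i) //= big1 ?addr0 => [|j /negbTE ji]; rewrite mderivZ mpolyXn mderivX.
  rewrite mulmnE mnm1E eqxx mul1n -scalerA mpolyXn; congr (_ *: (_ *: _)).
  congr mpolyX; apply/mnmP => j; rewrite mnmBE !mulmnE mnm1E.
  by case: eqP => _; rewrite ?mul1n ?mul0n ?subn1.
by rewrite mulmnE mnm1E ji mul0n scale0r scaler0.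
Qed.

(** At [i = j] the difference quotient becomes a derivative: [geom] gives the derivative of
    ['X_i ^+ k], and [a i] is its coefficient in [wpow a k]. *)
Lemma rdiff_diag s i a : a i *: rdiff s i i a = (\prod_(k <- s) wpow a k)^`M(i).
Proof.
elim: s => [|k s IH] /=; first by rewrite big_nil scaler0 -mpolyC1 mderivC.
rewrite big_cons mderivM -IH wpow_deriv scalerDr addrC; congr (_ + _).
  have -> : geom 'X_i 'X_i k = k%:R *: 'X_i ^+ k.-1.
    rewrite /geom (eq_bigr (fun=> 'X_i ^+ k.-1)) => [|b _].
      by rewrite sumr_const card_ord scaler_nat.
    by rewrite -exprD subnK // -ltnS prednK // (leq_trans _ (ltn_ord b)).
  by rewrite -!scalerAl scalerA.
by rewrite addrK scalerAr.
Qed.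

Lemma wspan_prod s : wspan (fun a => \prod_(k <- s) wpow a k).
Proof. by apply: wspan_ext (wspan_mon s (rpred1 _)) => a; rewrite mul1r. Qed.

Lemma wspan2_rdiff s : wspan2 (rdiff s).
Proof.
elim: s => [|k s IH] /=.
  by apply: wspan2_ext (wspan2_mon 0 0 (wspan_cst 0)) => i j a; rewrite mul0r.
have one : wspan (fun=> 1) by exact: wspan_cst.
apply: wspan2_add.
  apply: wspan2_ext (wspan2_add (wspan2_add (wspan2_mul 0 0 (wspan_wpow k) IH)
    (wspan2_mul k 0 one IH)) (wspan2_mul 0 k (wspan_cst (-1)) IH)) => i j a.
  by rewrite mpolyCN; ring.
rewrite /geom; elim: (index_enum _) => [|b r IHr].
  apply: wspan2_ext (wspan2_mon 0 0 (wspan_cst 0)) => i j a.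
  by rewrite big_nil !mul0r.
apply: wspan2_ext (wspan2_add (wspan2_mon (k.-1 - b) b (wspan_prod s)) IHr) => i j a.
by rewrite big_cons mulrDl mulrC.
Qed.

Definition shift a (i j : 'I_n) : 'I_n -> K := fun l => a l + ((l == i)%:R - (l == j)%:R).

Lemma wpow_shift a i j k : wpow (shift a i j) k = wpow a k + 'X_i ^+ k - 'X_j ^+ k.
Proof.
have D (i' : 'I_n) : \sum_(l < n) (l == i')%:R *: 'X_l ^+ k = 'X_i' ^+ k :> S.
  rewrite (bigD1 i') //= eqxx scale1r big1 ?addr0 // => l /negbTE ->.
  by rewrite scale0r.
rewrite -(D i) -(D j) -addrA -sumrB -big_split; apply: eq_bigr => l _ /=.
by rewrite scalerDl scalerBl.
Qed.

(** The exact quotients [D] are carried through the induction with [Psi], which keeps the whole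
    formula polynomial. *)
Lemma wspan_KW Phi : wspan Phi -> exists Psi D,
  [/\ wspan Psi,
      forall i j a, ('X_i - 'X_j) * D i j a = Phi (shift a i j) - Phi a
    & forall a, Psi a = \sum_i a i *: (Phi a)^`M(i)
        + \sum_i \sum_(j | i != j) (a j * (a i + 1)) *: D i j a].
Proof.
elim=> {Phi} [h s hs|Phi Phi' _ [P [D [h hD hP]]] _ [P' [D' [h' hD' hP']]]|Phi Phi' e _ [P [D [h hD hP]]]].
(* Completing the double sum costs [a_i (a_i + 1)] times the diagonal quotient; the derivative of
   the product supplies [a_i ^+ 2] times it by [rdiff_diag], leaving the last term, with coefficient
   [- a_i]. *)
- exists (fun a => (\sum_i a i *: h^`M(i)) * \prod_(k <- s) wpow a k
    + h * ((\sum_i \sum_j (a j * (a i + 1)) *: rdiff s i j a)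
           + (-1) *: \sum_i a i *: rdiff s i i a)), (fun i j a => h * rdiff s i j a).
  split.
  + apply: wspan_add; first exact: wspan_mul (wspan_deriv hs) (wspan_prod s).
    apply: (wspan_mul (wspan_sym hs)); apply: wspan_add.
      exact: wspan2_sum (wspan2_rdiff s).
    exact: wspan_scale (wspan2_diag (wspan2_rdiff s)).
  + move=> i j a; rewrite mulrCA rdiffP mulrBr; congr (_ * _ - _).
    by apply: eq_bigr => k _; rewrite wpow_shift.
  + move=> a; rewrite mulr_suml scaleN1r -sumrB mulr_sumr -!big_split.
    apply: eq_bigr => i _ /=; rewrite mderivM -rdiff_diag (bigD1 i) //=.
    under [X in _ = _ + X]eq_bigr => j _ do rewrite scalerAr.
    rewrite -mulr_sumr; under [X in _ = _ + h * X]eq_bigl => j do rewrite eq_sym.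
    by rewrite -!mul_mpolyC mpolyCM mpolyCD mpolyC1; ring.
- exists (fun a => P a + P' a), (fun i j a => D i j a + D' i j a); split.
  + exact: wspan_add.
  + by move=> i j a; rewrite mulrDr hD hD'; ring.
  + move=> a; rewrite hP hP' addrACA -!big_split; apply: eq_bigr => i _ /=.
    rewrite mderivD scalerDr -big_split; congr (_ + _); apply: eq_bigr => j _ /=.
    by rewrite scalerDr.
- exists P, D; split=> // [i j a|a]; first by rewrite hD !e.
  by rewrite hP -!e.
Qed.
End WeightedSpan.

(** * The big algebra *)

Section BigAlgebra.
Variables (C : numClosedFieldType) (n m : nat).
Hypothesis n_gt0 : (0 < n)%N.
Implicit Types (F G : polymap C n m) (phi psi : wtfun C n m) (mu : wt n m).

Definition wt_fun (Phi : ('I_n -> C) -> {mpoly C[n]}) : wtfun C n m :=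
  [ffun mu : wt n m => Phi (fun l => (mu l)%:R)].

Lemma hat_wtD F G (Phi Psi : ('I_n -> C) -> {mpoly C[n]}) :
  hat F (wt_fun Phi) -> hat G (wt_fun Psi) ->
  hat (F + G) (wt_fun (fun a => Phi a + Psi a)).
Proof.
move=> hF hG; suff -> : wt_fun (fun a => Phi a + Psi a)
  = [ffun mu => wt_fun Phi mu + wt_fun Psi mu] by apply: hatD.
by apply/ffunP => mu; rewrite !ffunE.
Qed.

Lemma hat_wtM F G (Phi Psi : ('I_n -> C) -> {mpoly C[n]}) :
  hat F (wt_fun Phi) -> hat G (wt_fun Psi) ->
  hat (F *m G) (wt_fun (fun a => Phi a * Psi a)).
Proof.
move=> hF hG; suff -> : wt_fun (fun a => Phi a * Psi a)
  = [ffun mu => wt_fun Phi mu * wt_fun Psi mu] by apply: hatM.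
by apply/ffunP => mu; rewrite !ffunE.
Qed.

(* A posteriori equivalent to [big_algebra]: see [big_medium] and [big_wspan]. *)
Definition medium F : Prop :=
  kirillov F /\ exists2 Phi, wspan Phi & hat F (wt_fun Phi).

Lemma mediumD F G : medium F -> medium G -> medium (F + G).
Proof.
move=> [kF [Phi hPhi hF]] [kG [Psi hPsi hG]]; split; first exact: kirillovD.
by exists (fun a => Phi a + Psi a); [exact: wspan_add|exact: hat_wtD].
Qed.

Lemma mediumM F G : medium F -> medium G -> medium (F *m G).
Proof.
move=> [kF [Phi hPhi hF]] [kG [Psi hPsi hG]]; split; first exact: kirillovM.
by exists (fun a => Phi a * Psi a); [exact: wspan_mul|exact: hat_wtM].
Qed.

Lemma medium_cst c : medium (c%:MP%:M).
Proof.
split; first by apply: kirillov_scalar => g Y _; rewrite !mevalC.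
exists (fun=> c%:MP); first exact: wspan_cst.
rewrite (_ : wt_fun _ = [ffun=> diag_restr c%:MP]); first exact: hat_scalar.
by apply/ffunP => mu; rewrite !ffunE diag_restrC.
Qed.

Lemma medium_c k : (k <= n)%N -> medium ((c_ C n k)%:M).
Proof.
move=> kn; split; first exact: kirillov_c.
exists (fun=> mesym n C k); first exact: wspan_sym (mesym_sym n C k).
exact: hat_c.
Qed.

Lemma medium_KW F : medium F -> medium (KW F).
Proof.
move=> [kF [Phi hPhi hF]]; split; first exact: kirillov_KW.
have [Psi [D [hPsi hD eP]]] := wspan_KW hPhi; exists Psi => //.
have [psi hG] : exists psi, hat (KW F) psi.
  by eexists; apply: kirillov_hat (kirillov_KW kF).
suff -> : wt_fun Psi = psi by [].
(* The comparison is made in the fraction field, where each [D] cancels its denominator. *)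
apply/ffunP => mu; apply/eqP; rewrite -tofrac_eq.
rewrite (KW_formula mu kF (wspan_eq hPhi) hF hG) ffunE eP rmorphD; apply/eqP.
congr (_ + _); rewrite rmorph_sum; apply: eq_bigr => i _; rewrite rmorph_sum.
apply: eq_bigr => j ij /=.
have := hD i j (fun l => (mu l)%:R); rewrite /shift => <-.
rewrite tofracM mulrA mulfVK ?tofrac_X_neq0 //.
by rewrite -mul_mpolyC tofracM natr1 -natrM mpolyC_nat rmorph_nat.
Qed.

(** The generators arise from the [c_k] by iterating [KW], under which [medium] is stable. *)
Lemma big_medium F : big_algebra F -> medium F.
Proof.
elim=> {F} [p q pq||c F _ hF|F G _ hF _ hG|F G _ hF _ hG].
- by elim: (q in iter q) => [|k IH]; [exact: medium_c|exact: medium_KW].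
- by rewrite -[1%:M]/((1%:MP)%:M); apply: medium_cst.
- by rewrite -mul_scalar_mx; apply: mediumM => //; apply: medium_cst.
- exact: mediumD.
- exact: mediumM.
Qed.

Lemma big_kirillov F : big_algebra F -> kirillov F.
Proof. by move=> /big_medium[]. Qed.

Lemma KWD F G : KW (F + G) = KW F + KW G.
Proof.
rewrite -big_split; apply: eq_bigr => i _ /=; rewrite -big_split; apply: eq_bigr => j _ /=.
by rewrite -mulmxDl; congr (_ *m _); apply/matrixP => a b; rewrite !mxE mderivD.
Qed.

Lemma KW_scalar (p : gl_poly C n) : KW (p%:M : polymap C n m) =
  \sum_(i < n) \sum_(j < n) p^`M(mxvec_index j i) *:
    map_mx (@mpolyC (n * n) C) (gl_rep m (delta_mx i j)).
Proof.
apply: eq_bigr => i _; apply: eq_bigr => j _; rewrite -mul_scalar_mx; congr (_ *m _).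
by apply/matrixP => a b; rewrite !mxE mderivMn.
Qed.

Lemma KW_scalarM (p q : gl_poly C n) : KW ((p * q)%:M : polymap C n m) =
  p%:M *m KW q%:M + q%:M *m KW p%:M.
Proof.
rewrite !KW_scalar !mul_scalar_mx !scaler_sumr -big_split; apply: eq_bigr => i _ /=.
rewrite !scaler_sumr -big_split; apply: eq_bigr => j _ /=.
rewrite !scalerA -scalerDl mderivM; congr (_ *: _).
by rewrite addrC [_ * q]mulrC.
Qed.

(* The symmetric functions of [t] are the restrictions of polynomials in the
   [c_k], on which [KW] is a derivation. *)
Lemma big_sym (h : {mpoly C[n]}) : h \is symmetric -> exists p : gl_poly C n,
  [/\ diag_restr p = h, big_algebra (p%:M : polymap C n m)
    & big_algebra (KW (p%:M : polymap C n m))].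
Proof.
move=> /sym_fundamental[t [<- _]].
have cst c : big_algebra ((c%:MP)%:M : polymap C n m).
  by rewrite -[c%:MP]mulr1 -scale_scalar_mx; apply/big_scale/big_one.
elim/mpoly_alg_ind: t => [c|i|f g [p [hp bp dp]] [q [hq bq dq]]|f g [p [hp bp dp]] [q [hq bq dq]]].
- exists c%:MP; split; [by rewrite diag_restrC comp_mpolyC|exact: cst|].
  have -> : KW ((c%:MP)%:M : polymap C n m) = (0%:MP)%:M; last exact: cst.
  rewrite KW_scalar big1 => [|i _]; first by rewrite mpolyC0 raddf0.
  by rewrite big1 // => j _; rewrite mderivC scale0r.
- exists (c_ C n i.+1); rewrite c_diag comp_mpolyXU -tnth_nth tnth_mktuple; split=> //.
    by have := @big_gen C n m i.+1 0; rewrite addn0 => /(_ (ltn_ord i)).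
  by have := @big_gen C n m i 1; rewrite addn1 => /(_ (ltn_ord i)).
- have pqD : (p + q)%:M = p%:M + q%:M :> polymap C n m := raddfD _ p q.
  exists (p + q); split; first by rewrite diag_restrD hp hq comp_mpolyD.
    by rewrite pqD; apply: big_add.
  by rewrite pqD KWD; apply: big_add.
- exists (p * q); split; first by rewrite diag_restrM hp hq rmorphM.
    by rewrite scalar_mxM; apply: big_mul.
  by rewrite KW_scalarM; apply: big_add; apply: big_mul.
Qed.

Lemma big_wpow k : exists2 F, big_algebra F & hat F (wt_fun (fun a => wpow a k)).
Proof.
(* The exponent is one higher because [KW] lowers the degree by one; [k = 0] is reached from the
   first power sum. *)
have [p [hp bp dp]] := big_sym (psum_sym C n k.+1).
have h0 : hat (p%:M : polymap C n m) (wt_fun (fun=> wpow (fun=> 1) k.+1)).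
  rewrite -hp; exact: hat_scalar.
have kp := big_kirillov bp.
have [psi hG] : exists psi, hat (KW (p%:M : polymap C n m)) psi.
  by eexists; apply: kirillov_hat (kirillov_KW kp).
exists ((k.+1%:R^-1)%:MP *: KW p%:M); first exact: big_scale.
rewrite -mul_scalar_mx.
suff -> : wt_fun (fun a => wpow a k) = [ffun mu => [ffun=> diag_restr (k.+1%:R^-1)%:MP] mu * psi mu].
  by apply: hatM => //; apply: hat_scalar.
apply/ffunP => mu; rewrite !ffunE diag_restrC mul_mpolyC.
have -> : psi mu = k.+1%:R *: wpow (fun l => (mu l)%:R) k.
  apply/eqP; rewrite -tofrac_eq (KW_formula mu kp _ h0 hG) //.
  (* The restriction of a scalar map is the same at every weight, so all divided differences
     vanish. *)
  rewrite [X in _ + X]big1 ?addr0 => [|i _]; last first.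
    by rewrite big1 // => j _; rewrite subrr rmorph0 mulr0.
  rewrite tofrac_eq; apply/eqP; rewrite scaler_sumr; apply: eq_bigr => i _.
  by rewrite wpow_deriv mul1r !scalerA mulrC.
by rewrite scalerA mulVf ?scale1r // pnatr_eq0.
Qed.

Lemma big_wspan Phi : wspan Phi -> exists2 F, big_algebra F & hat F (wt_fun Phi).
Proof.
elim=> {Phi} [h s hs|Phi Psi _ [F bF hF] _ [G bG hG]|Phi Psi e _ [F bF hF]].
- have [F bF hF] : exists2 F : polymap C n m, big_algebra F & hat F (wt_fun (fun=> h)).
    have [p [<- bp _]] := big_sym hs; exists p%:M => //; exact: hat_scalar.
  have [G bG hG] : exists2 G : polymap C n m, big_algebra G &
      hat G (wt_fun (fun a => \prod_(k <- s) wpow a k)).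
    elim: s => [|k s [G bG hG]].
      exists 1%:M; first exact: big_one.
      suff -> : wt_fun (fun a => \prod_(k <- [::]) wpow a k) = [ffun=> diag_restr 1].
        exact: hat_scalar.
      by apply/ffunP => mu; rewrite !ffunE big_nil -mpolyC1 diag_restrC.
    have [H bH hH] := big_wpow k; exists (H *m G); first exact: big_mul.
    suff -> : wt_fun (fun a => \prod_(l <- k :: s) wpow a l) =
        wt_fun (fun a => wpow a k * \prod_(l <- s) wpow a l) by apply: hat_wtM.
    by apply/ffunP => mu; rewrite !ffunE big_cons.
  by exists (F *m G); [exact: big_mul|exact: hat_wtM].
- by exists (F + G); [exact: big_add|exact: hat_wtD].
- exists F => //; suff <- : wt_fun Phi = wt_fun Psi by [].
  by apply/ffunP => mu; rewrite !ffunE e.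
Qed.

(** [KW F] lies over the span, hence has the same image as some element of the big algebra;
    injectivity on equivariant maps identifies the two. *)
Lemma big_KW F : big_algebra F -> big_algebra (KW F).
Proof.
move=> bF; have [kG [Phi hPhi hG]] := medium_KW (big_medium bF).
have [H bH hH] := big_wspan hPhi.
by rewrite (hat_inj n_gt0 kG (big_kirillov bH) hG hH).
Qed.
End BigAlgebra.

(** * Plethystic substitution and the final formula *)

Lemma wspan_pleth (K : numFieldType) (n : nat) (g : Lambda K) :
  wspan (fun a : 'I_n -> K => pleth a g).
Proof.
apply: wspan_sum => e; apply: wspan_mul; first exact: wspan_cst.
elim: (finsupp e : seq nat) => [|k r IH].
  by apply: wspan_ext (wspan_cst n 1) => a; rewrite big_nil.
(* Index [k] of [Lambda] stands for the power sum of exponent [k.+1]. *)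
suff he : wspan (fun a : 'I_n -> K => wpow a k.+1 ^+ e k).
  by apply: wspan_ext (wspan_mul he IH) => a; rewrite big_cons.
elim: (e k) => [|d IHd]; first by apply: wspan_ext (wspan_cst n 1) => a; rewrite expr0.
by apply: wspan_ext (wspan_mul (wspan_wpow K n k.+1) IHd) => a; rewrite exprS.
Qed.

Lemma pleth_sym (K : numFieldType) (n : nat) (f : Lambda K) :
  pleth (fun _ : 'I_n => 1) f \is symmetric.
Proof.
apply: rpred_sum => e _; rewrite mul_mpolyC; apply: rpredZ.
by apply: rpred_prod => k _; apply: rpredX; apply: psum_sym.
Qed.

(** Algebraic closedness serves the density of diagonalizable matrices. As [Dhat] is a relation,
    existence of [psi] accompanies the formula, which could otherwise be vacuous. *)
Theorem KW_symmetric_power (C : numClosedFieldType) (n m : nat) (hn : (0 < n)%N) :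
  [/\ (forall F : polymap C n m, big_algebra F -> kirillov F /\ big_algebra (KW F)),
      (forall F : polymap C n m, big_algebra F -> exists! phi, hat F phi),
      (forall (F G : polymap C n m) phi,
         big_algebra F -> big_algebra G -> hat F phi -> hat G phi -> F = G)
    & forall f g : Lambda C,
        (exists psi, Dhat (fg_fun n m f g) psi) /\
        forall psi, Dhat (fg_fun n m f g) psi ->
        forall mu : wt n m,
          let f1 := pleth (fun _ => 1) f in
          let gmu := pleth (fun l => (mu l)%:R) g in
          tofrac (psi mu) =
            tofrac (\sum_(i < n) (mu i)%:R *: (f1 * gmu)^`M(i))
            + tofrac f1 *
              \sum_(i < n) \sum_(j < n | i != j)
                (mu j * (mu i).+1)%:R / tofrac ('X_i - 'X_j) *
                tofrac (pleth (fun l => (mu l)%:R + ((l == i)%:R - (l == j)%:R)) g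
                        - gmu)
  ].
Proof.
split=> [F bF|F bF|F G phi bF bG|f g].
- by split; [exact: big_kirillov bF|exact: big_KW].
- have hF := kirillov_hat (big_kirillov bF).
  by eexists; split=> [|psi hpsi]; [exact: hF|exact: hat_uniq hF hpsi].
- exact: hat_inj hn (big_kirillov bF) (big_kirillov bG).
have hPhi : wspan (fun a : 'I_n -> C => pleth (fun=> 1) f * pleth a g).
  exact: wspan_mul (wspan_sym (pleth_sym n f)) (wspan_pleth n g).
split=> [|psi [F [bF hF hG]] mu].
  have [F bF hF] := big_wspan m hPhi.
  have hG := kirillov_hat (kirillov_KW (big_kirillov bF)).
  by eexists; exists F; split; [exact: bF|exact: hF|exact: hG].
(* The factor from [f] does not depend on the weight, so it comes out of every divided
   difference. *)
rewrite (KW_formula mu (big_kirillov bF) (wspan_eq hPhi) hF hG); congr (_ + _).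
rewrite [RHS]mulr_sumr; apply: eq_bigr => i _; rewrite [RHS]mulr_sumr.
by apply: eq_bigr => j _; rewrite -mulrBr tofracM [RHS]mulrCA.
Qed.

Theorem proposition8p32 (R : realType) (n m : nat) (hn : (0 < n)%N) (hm : (0 < m)%N) :
  [/\ (* B is contained in C(V) and stable under D *)
      (forall F : polymap R[i] n m, big_algebra F -> kirillov F /\ big_algebra (KW F)),
      (* i_m is a well-defined map on B, and is injective *)
      (forall F : polymap R[i] n m, big_algebra F -> exists! phi, hat F phi),
      (forall (F G : polymap R[i] n m) phi,
         big_algebra F -> big_algebra G -> hat F phi -> hat G phi -> F = G)
    & forall f g : Lambda R[i],
        (exists psi, Dhat (fg_fun n m f g) psi) /\
        forall psi, Dhat (fg_fun n m f g) psi ->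
        forall mu : wt n m,
          let f1 := pleth (fun _ => 1) f in
          let gmu := pleth (fun l => (mu l)%:R) g in
          tofrac (psi mu) =
            tofrac (\sum_(i < n) (mu i)%:R *: (f1 * gmu)^`M(i))
            + tofrac f1 *
              \sum_(i < n) \sum_(j < n | i != j)
                (mu j * (mu i).+1)%:R / tofrac ('X_i - 'X_j) *
                tofrac (pleth (fun l => (mu l)%:R + ((l == i)%:R - (l == j)%:R)) g
                        - gmu)
  ].
Proof. exact: (@KW_symmetric_power R[i] n m hn). Qed.
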